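(* There are positive constants $c_1, c_2$ and $\alpha_1\ge\alpha_2>0$ such that for every intensity $\lambda>0$, every $v\in\mathbb{R}^2$, every $d_v\in\{(1,0),(0,1)\}$, every $t>0$ and every $T>t$, the rectangular Gilbert tessellation model $G_{\mathcal V}$ with random set $\mathcal V$ generated by a Poisson process in $\mathbb{R}^2$ of intensity $\lambda$ satisfies $$c_1 e^{-\alpha_1\sqrt{\lambda}\,t}\le \mathbb{P}\{\,|\mathcal{L}^+_{v,d_v}(T)\cup\mathcal{L}^-_{v,d_v}(T)|>t \mid v\in\mathcal V\}\le c_2 e^{-\alpha_2\sqrt{\lambda}\,t},$$ where $|\cdot|$ denotes length.
   Context: Rectangular Gilbert tessellation model: let $\mathcal V$ be the set of points of a homogeneous Poisson process on $\mathbb{R}^2$ with intensity $\lambda>0$. Each $u\in\mathcal V$ is assigned, independently of everything else, a direction $d_u\in\{(0,1),(1,0)\}$, each with probability $1/2$. At time $0$, from every $u\in\mathcal V$ two rays $\mathcal L^{+}_{u,d_u}$ and $\mathcal L^{-}_{u,d_u}$ start growing, in directions $+d_u$ and $-d_u$ respectively, with constant speed $1$; a ray grows until its tip reaches another ray (i.e. touches a point of a ray of another initial point as grown up to that time), at which moment it stops and remains unchanged thereafter. $\mathcal L^{\pm}_{u,d_u}(t)$ denotes the (closed) segment occupied by the ray at time $t$, with $\mathcal L^\pm_{u,d_u}(0)=\{u\}$, and $G_{\mathcal V}(t)=\bigcup_{u\in\mathcal V}(\mathcal L^{+}_{u,d_u}(t)\cup \mathcal L^{-}_{u,d_u}(t))$.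 Given the initial points and their directions the dynamics is deterministic. Conditioning on $\{v\in\mathcal V\}$ for a fixed $v$ (with given $d_v$) means: the process is run from the initial set $\mathcal V\cup\{v\}$, where $\mathcal V$ is the Poisson process with its independent random directions and $v$ has the given direction $d_v$. *)

(* Defs.v *)
From HB Require Import structures.
From mathcomp Require Import all_boot all_order all_algebra finmap.
From mathcomp Require Import all_classical all_reals all_analysis.

Set Implicit Arguments.
Unset Strict Implicit.
Unset Printing Implicit Defensive.
Import Order.TTheory GRing.Theory Num.Theory.
Import numFieldNormedType.Exports.

Local Open Scope classical_set_scope.
Local Open Scope ring_scope.

Section deterministic_dynamics.
Context {R : realType}.

(* An initial point together with its direction: [true] stands for (1, 0) and
   [false] for (0, 1). *)
Definition germ : Type := (R * R * bool)%type.

Definition dirvec (d : bool) : R * R := if d then (1, 0) else (0, 1).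

(* u + r d_u, for a signed r *)
Definition line_pt (g : germ) (r : R) : R * R :=
  (g.1.1 + r * (dirvec g.2).1, g.1.2 + r * (dirvec g.2).2).

(* The ray L^+ has index [s = false] and L^- has index [s = true]; this is the
   position at time [t] of the tip of a ray that has not been stopped. *)
Definition tip (g : germ) (s : bool) (t : R) : R * R :=
  line_pt g ((-1) ^+ s * t).

(* [tau g s] is the time at which the ray [s] of [g] stops, +oo if it never
   does. *)
Definition stop_times : Type := germ -> bool -> \bar R.

(* The closed segment occupied at time [t] by the ray [s] of [g]. *)
Definition ray (tau : stop_times) (g : germ) (s : bool) (t : R) : set (R * R) :=
  [set tip g s r | r in [set r : R | 0 <= r <= t /\ (r%:E <= tau g s)%E]].

Definition hits (S : set germ) (tau : stop_times) (g : germ) (s : bool)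
    (t : R) : Prop :=
  exists h s', [/\ S h, h.1 <> g.1 & ray tau h s' t (tip g s t)].

(* Every ray stops exactly at the first time at which its tip touches a ray of
   another initial point, as grown up to that time. *)
Definition gilbert_evolution (S : set germ) (tau : stop_times) : Prop :=
  forall g s, S g ->
    match tau g s with
    | t%:E => [/\ 0 <= t, hits S tau g s t &
                  forall r, 0 <= r < t -> ~ hits S tau g s r]
    | +oo%E => forall r, 0 <= r -> ~ hits S tau g s r
    | -oo%E => False
    end.

(* The evolution started from [S].  For almost every realization of the Poisson
   process it exists and is unique on [S]; the default value is irrelevant. *)
Definition gilbert (S : set germ) : stop_times :=
  xget (fun _ _ => 0%E) [set tau | gilbert_evolution S tau].

(* Length of a subset of the line through the point of [g] in its direction
   (a unit vector): the Lebesgue measure of the arc length parameters. *)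
Definition line_length (g : germ) (A : set (R * R)) : \bar R :=
  lebesgue_measure [set r : R | A (line_pt g r)].

(* |L^+_g(T) U L^-_g(T)| for the evolution started from [S] *)
Definition gilbert_length (S : set germ) (g : germ) (T : R) : \bar R :=
  line_length g (ray (gilbert S) g false T `|` ray (gilbert S) g true T).

End deterministic_dynamics.
Arguments germ : clear implicits.
Arguments stop_times : clear implicits.

Section probability.
Context d (Omega : measurableType d) {R : realType} (P : probability Omega R).

(* Mutual independence of a family of classes of events (for classes that are
   stable under intersection, up to the empty set). *)
Definition mutually_independent (I : choiceType) (F : I -> set (set Omega)) :=
  forall (J : {fset I}) (E : I -> set Omega),
    (forall i, i \in J -> F i (E i)) ->
    P (\bigcap_(i in [set` J]) E i) = (\prod_(i <- J) P (E i))%E.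

Definition sigma_of d' (T : measurableType d') (X : Omega -> T) :
  set (set Omega) := preimage_set_system setT X measurable.

(* a <= P A <= b, for the inner and outer probability: for a measurable [A] this
   is [a <= P A <= b] by [prob_betweenE], and in general it forces that inequality
   in every extension of [P] (such as its completion) that measures [A].  The
   evolution is determined by the Poisson points only almost surely, so that an
   event about it need not be in the given sigma-algebra, which is not assumed
   to be complete. *)
Definition prob_between (A : set Omega) (a b : \bar R) : Prop :=
  (exists E, [/\ measurable E, E `<=` A & (a <= P E)%E]) /\
  (exists E, [/\ measurable E, A `<=` E & (P E <= b)%E]).

Lemma prob_betweenE (A : set Omega) (a b : \bar R) : measurable A ->
  prob_between A a b <-> (a <= P A <= b)%E.
Proof.
move=> mA; split=> [[[E [mE EA aE]] [F [mF AF Fb]]]|/andP[aA Ab]].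
  apply/andP; split.
    by apply: (le_trans aE); apply: le_measure => //; rewrite inE.
  by apply: le_trans Fb; apply: le_measure => //; rewrite inE.
by split; exists A; split.
Qed.

(* The event that [B] contains exactly [k] points of the random set [V]. *)
Definition count_event (V : Omega -> set (R * R)) (B : set (R * R)) (k : nat) :
  set Omega := [set w | (V w `&` B #= `I_k)%card].

Definition area (B : set (R * R)) : \bar R :=
  ((@lebesgue_measure R) \x (@lebesgue_measure R))%E B.

(* The second argument of [poisson_prob] is a dummy one. *)
Definition poisson_process (lambda : R) (V : Omega -> set (R * R)) : Prop :=
  (forall (B : set (R * R)) k, measurable B -> (area B < +oo)%E ->
     P (count_event V B k) =
     poisson_prob (lambda * fine (area B)) 0%N [set k]) /\
  (forall B : nat -> set (R * R), (forall i, measurable (B i)) ->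
     trivIset setT B ->
     mutually_independent (fun i => [set count_event V (B i) k | k in setT])).

Definition point_set (U : nat -> Omega -> R * R) (w : Omega) : set (R * R) :=
  [set U n w | n in setT].

(* [U] enumerates the points of the Poisson process and [D n] is the direction
   of [U n]; the directions are fair, independent of each other and of the
   points. *)
Definition poisson_germs (lambda : R) (U : nat -> {RV P >-> (R * R)%type})
    (D : nat -> {RV P >-> bool}) : Prop :=
  [/\ {ae P, forall w, injective (fun n => U n w)},
      poisson_process lambda (point_set U),
      (forall n b, P (D n @^-1` [set b]) = (2^-1)%:E) &
      mutually_independent (fun o : option nat =>
        if o is Some n then sigma_of (D n)
        else <<s \bigcup_n sigma_of (U n) >>)].

Definition germ_set (U : nat -> Omega -> R * R) (D : nat -> Omega -> bool)
    (w : Omega) : set (germ R) := [set (U n w, D n w) | n in setT].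

End probability.

(* Main.v *)
(** The rays are handled through local configurations in the cells of a grid of
    mesh a = 1 / sqrt lambda around v, whose cells contain one point on average.

    Upper bound.  In a row of three cells along the ray of v, suppose that the
    outer two are empty and that the middle one contains a single point, growing
    perpendicularly.  Nothing can stop the latter before it reaches the line of
    v, hence it blocks the ray of v.  Disjoint triples are independent and each
    of them blocks with a probability that does not depend on lambda.

    Lower bound.  In a column of four cells across the line of v, suppose that
    the two inner cells contain one point each, growing parallel to v, and that
    the outer two are empty.  The inner points span their column before any
    perpendicular ray coming from outside reaches them, and shield the ray of v.
    It suffices to have about t / a such columns in a row.

    The lower bound also needs the existence of the evolution, almost surely.
    If stopping is noticed with a delay e > 0, the dynamics is well founded; an
    ultrafilter limit as e -> 0 is an evolution for any locally finite set of
    germs without two equal coordinates. *)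
Require Import Defs.
From mathcomp Require Import all_boot all_order all_algebra finmap.
From mathcomp Require Import all_classical all_reals all_analysis.
From mathcomp Require Import measurable_realfun lra ring zify.

Set Implicit Arguments.
Unset Strict Implicit.
Unset Printing Implicit Defensive.
Import Order.TTheory GRing.Theory Num.Theory.
Import numFieldNormedType.Exports.

Local Open Scope classical_set_scope.
Local Open Scope ring_scope.

(** * Existence of the evolution *)

Section dynamics.
Context {R : realType}.
Implicit Types (S : set (germ R)) (g h : germ R) (s : bool) (t b r : R).

Definition axis (d : bool) (p : R * R) : R := if d then p.1 else p.2.

Lemma axis_inj (d : bool) (p q : R * R) :
  axis d p = axis d q -> axis (~~ d) p = axis (~~ d) q -> p = q.
Proof. by case: p q d => [p1 p2] [q1 q2] [] /= -> ->. Qed.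

Lemma axis_tip g s t : axis g.2 (tip g s t) = axis g.2 g.1 + (-1) ^+ s * t.
Proof. by case: g => [[x y] []]; rewrite /axis /= mulr1. Qed.

Lemma axis_tip_orth g s t : axis (~~ g.2) (tip g s t) = axis (~~ g.2) g.1.
Proof. by case: g => [[x y] []]; rewrite /axis /= mulr0 addr0. Qed.

Definition generic S := forall g h, S g -> S h -> g <> h ->
  forall d, axis d g.1 <> axis d h.1.

Definition locally_finite S := forall M : R,
  finite_set [set g | S g /\ forall d, `|axis d g.1| <= M].

(** Encounter of trajectories that are never stopped: the second tip passes at time [b] the point
    reached at time [t]. Survival is kept apart, so that the geometry involves no stopping times. *)
Definition meet S g s t h s' b :=
  [/\ S h, h.1 <> g.1, 0 <= b <= t & tip h s' b = tip g s t].

Lemma hits_meet S tau g s t : hits S tau g s t <->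
  exists h s' b, meet S g s t h s' b /\ (b%:E <= tau h s')%E.
Proof.
split=> [[h [s' [Sh hg [b [bt btau] e]]]]|[h [s' [b [[Sh hg bt e] btau]]]]].
  by exists h, s', b.
by exists h, s'; split => //; exists b.
Qed.

(** Parallel rays of distinct germs lie on distinct lines by genericity, so an encounter is
    perpendicular and amounts to two scalar equations. *)
Lemma meetP S g s t h s' b : generic S -> S g ->
  meet S g s t h s' b <->
  [/\ S h, h.2 = ~~ g.2, 0 <= b <= t,
      axis g.2 h.1 = axis g.2 g.1 + (-1) ^+ s * t &
      axis h.2 g.1 = axis h.2 h.1 + (-1) ^+ s' * b].
Proof.
move=> genS Sg; split=> [[Sh hg bt e]|[Sh hg bt e1 e2]].
  have hneg : h <> g by move=> hgE; apply: hg; rewrite hgE.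
  have h2 : h.2 = ~~ g.2.
    have [h2E|] := eqVneq h.2 g.2; last by case: (h.2) (g.2) => [] [].
    case: (genS _ _ Sh Sg hneg (~~ g.2)).
    by rewrite -(axis_tip_orth g s t) -e -h2E axis_tip_orth.
  split=> //; first by rewrite -axis_tip -e -(negbK g.2) -h2 axis_tip_orth.
  by rewrite -axis_tip e h2 axis_tip_orth.
split=> // [hgE|].
  have hneg : h <> g by move=> hgE'; move: hg; rewrite hgE'; case: g.2.
  by case: (genS _ _ Sh Sg hneg true); rewrite hgE.
apply: (@axis_inj g.2).
  by rewrite axis_tip -e1 -(negbK g.2) -hg axis_tip_orth.
by rewrite -hg axis_tip -e2 hg axis_tip_orth.
Qed.

Lemma meet_ge0 S g s t h s' b : meet S g s t h s' b -> 0 <= t.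
Proof. by case=> _ _ /andP[b0 bt] _; apply: le_trans bt. Qed.

(** The time [t] fixes one coordinate of the other germ, hence the germ itself by genericity. Its
    offset from [g] in the other coordinate is nonzero and fixes the sign and [b]. *)
Lemma meet_uniq S g s t h1 s1 b1 h2 s2 b2 : generic S -> S g ->
  meet S g s t h1 s1 b1 -> meet S g s t h2 s2 b2 ->
  [/\ h1 = h2, s1 = s2 & b1 = b2].
Proof.
move=> genS Sg /(meetP _ _ _ _ _ genS Sg)[Sh1 h1g b1t e1 f1].
move=> /(meetP _ _ _ _ _ genS Sg)[Sh2 h2g b2t e2 f2].
have h12 : h1 = h2.
  apply: contrapT => h12; apply: (genS _ _ Sh1 Sh2 h12 g.2).
  by rewrite e1 e2.
subst h2; have : axis h1.2 g.1 <> axis h1.2 h1.1.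
  by apply: genS => // gh; move: h1g; rewrite gh; case: (h1.2).
by clear -b1t b2t f1 f2; case: s1 s2 f1 f2 => [] [];
  rewrite ?expr1 ?expr0; split=> //; lra.
Qed.

(** A germ met by time [T] is within [|T|] of [g] in each coordinate, and it determines the time of
    the encounter. This discreteness makes first hits attained and leaves the ultrafilter finitely
    many times to treat. *)
Lemma meet_times_finite S g s T : generic S -> locally_finite S -> S g ->
  finite_set [set t | t <= T /\ exists h s' b, meet S g s t h s' b].
Proof.
move=> genS lfS Sg.
pose M := Num.max `|axis true g.1| `|axis false g.1| + `|T|.
apply: (@sub_finite_set _ _
  [set (-1) ^+ s * (axis g.2 h.1 - axis g.2 g.1) | h in
    [set h | S h /\ forall d, `|axis d h.1| <= M]]); last first.
  exact/finite_image/lfS.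
move=> t [tT [h [s' [b me]]]].
have [Sh hg /andP[b0 bt] e1 e2] := (meetP _ _ _ _ _ genS Sg).1 me.
exists h; last first.
  by rewrite e1 addrC addKr mulrA -signr_addb addbb mul1r.
have t0 : 0 <= t by apply: le_trans bt.
have MT : t <= `|T| by rewrite (le_trans tT)// ler_norm.
have Mg d : `|axis d g.1| + `|T| <= M.
  by rewrite lerD2r le_max; case: d; rewrite lexx ?orbT.
split=> // d; have [->|] := eqVneq d g.2.
  rewrite e1 (le_trans _ (Mg g.2))// (le_trans (ler_normD _ _))// lerD2l.
  by rewrite normrM normr_sign mul1r ger0_norm.
move=> dg; have -> : d = h.2 by rewrite hg; case: d (g.2) dg => [] [].
have -> : axis h.2 h.1 = axis h.2 g.1 - (-1) ^+ s' * b by rewrite e2 addrK.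
rewrite (le_trans _ (Mg h.2))// (le_trans (ler_normB _ _))// lerD2l.
by rewrite normrM normr_sign mul1r ger0_norm// (le_trans bt).
Qed.

(* [H g s t]: if it were not stopped before, the ray [s] of [g] would touch another
   ray at time [t].  The ray stops at the first such [t]. *)
Definition hit_rel S (H : germ R -> bool -> R -> Prop) := forall g s t, S g ->
  H g s t <-> exists h s' b, meet S g s t h s' b /\
    forall r, 0 <= r < b -> ~ H h s' r.

(** The absence of hits before [b] is the same as [b] being at most the infimum of the hits, so the
    two notions of survival agree. Local finiteness turns a finite infimum into a minimum. *)
Lemma evolution_of_hit_rel S H : generic S -> locally_finite S ->
  hit_rel S H ->
  gilbert_evolution S (fun g s => ereal_inf [set t%:E | t in H g s]).
Proof.
move=> genS lfS HH; set tau := fun g s => _.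
have Hge0 g s t : S g -> H g s t -> 0 <= t.
  by move=> Sg /(HH _ _ _ Sg)[h [s' [b [/meet_ge0]]]].
have letau g s b : S g ->
    (b%:E <= tau g s)%E <-> forall r, 0 <= r < b -> ~ H g s r.
  move=> Sg; split=> [btau r /andP[r0 rb] Hr|nH].
    have : (b%:E <= r%:E)%E.
      by apply: (le_trans btau); apply: ereal_inf_lbound; exists r.
    by rewrite lee_fin leNgt rb.
  apply: le_ereal_inf_tmp => _ [r Hr <-]; rewrite lee_fin leNgt.
  by apply/negP => rb; case: (nH r); rewrite ?rb ?(Hge0 _ _ _ Sg Hr).
have hitsH g s t : S g -> hits S tau g s t <-> H g s t.
  move=> Sg; rewrite hits_meet (HH _ _ _ Sg); split.
    move=> [h [s' [b [me btau]]]]; exists h, s', b; split => //.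
    by apply/letau => //; case: me.
  move=> [h [s' [b [me nH]]]]; exists h, s', b; split => //.
  by apply/letau => //; case: me.
move=> g s Sg.
have tau_lb r : (r%:E < tau g s)%E -> ~ H g s r.
  move=> rtau Hr; move: rtau; rewrite ltNge => /negP; apply.
  by apply: ereal_inf_lbound; exists r.
case E : (tau g s) => [t| |].
- have t0 : 0 <= t.
    by rewrite -lee_fin -E; apply/letau => // r; rewrite ltNge; case: (0 <= r).
  split=> // [|r /andP[r0 rt]]; last first.
    by move/(hitsH _ _ _ Sg); apply: tau_lb; rewrite E lte_fin.
  apply/hitsH => //; apply: contrapT => nHt.
  (* With [m] the next candidate time after [t], capped at [t + 1], a ray without a hit at [t] has
     none before [m], against [t] being the infimum. *)
  pose F := [set r | r <= t + 1 /\ exists h s' b, meet S g s r h s' b].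
  have [X FX] : exists X : seq R, F = [set` X].
    by apply/finite_seqP/meet_times_finite.
  pose m := \big[Order.min/(t + 1)]_(x <- X | x > t) x.
  have mt : t < m.
    rewrite /m; elim/big_ind : _ => //; first by rewrite ltrDl.
    by move=> x y tx ty; rewrite lt_min tx.
  have mX x : x \in X -> t < x -> m <= x.
    by move=> xX tx; apply: (@ge_bigmin_seq _ _ _ X _ x (fun y => t < y) id).
  suff : (m%:E <= tau g s)%E by rewrite E lee_fin leNgt mt.
  apply/letau => // r /andP[r0 rm] Hr.
  have : t <= r by rewrite -lee_fin -E; apply: ereal_inf_lbound; exists r.
  rewrite le_eqVlt => /orP[/eqP tr|tr]; first by apply: nHt; rewrite tr.
  have : F r.
    split; first exact/(le_trans (ltW rm))/bigmin_le_id.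
    by have [h [s' [b [? _]]]] := (HH _ _ _ Sg).1 Hr; exists h, s', b.
  rewrite FX /= => rX.
  by move: (mX _ rX tr); rewrite leNgt rm.
- move=> r r0 /(hitsH _ _ _ Sg); apply: tau_lb.
  by rewrite E ltry.
- have : (0%:E <= tau g s)%E.
    by apply/letau => // r; rewrite ltNge; case: (0 <= r).
  by rewrite E.
Qed.

(* The dynamics in which the stopping of a ray is noticed with a delay e is well
   founded, with [k] bounding the number of delays that fit in the time. *)
Fixpoint delayed_hit S (e : R) (k : nat) g s t : Prop :=
  if k is k'.+1 then
    exists h s' b, meet S g s t h s' b /\
      forall r, 0 <= r -> r + e < b -> ~ delayed_hit S e k' h s' r
  else False.

(** Each unfolding lowers the time by more than [e], and no encounter has a negative time; hence all
    fuels exceeding [t / e] agree. *)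
Lemma delayed_hit_fuel S e k k' g s t : 0 < e ->
  t < e * k%:R -> t < e * k'%:R ->
  delayed_hit S e k g s t <-> delayed_hit S e k' g s t.
Proof.
have neg j g1 s1 t1 : t1 < e * 0%:R -> ~ delayed_hit S e j g1 s1 t1.
  rewrite mulr0 => t0; case: j => // j [h [s' [b [/meet_ge0]]]].
  by rewrite leNgt t0.
move=> e0; elim: k k' g s t => [|k IH] [|k'] g s t tk tk' //.
- by split=> // /(neg _ _ _ _ tk).
- by split=> // /(neg _ _ _ _ tk').
rewrite -natr1 mulrDr mulr1 in tk; rewrite -natr1 mulrDr mulr1 in tk'.
split=> -[h [s' [b [me nH]]]]; exists h, s', b; split => // r r0 reb Hr;
  have bt : b <= t by case: me => _ _ /andP[].
- by apply: (nH r r0 reb); apply/(IH k') => //; lra.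
- by apply: (nH r r0 reb); apply/(IH k') => //; lra.
Qed.

(** An ultrafilter limit commutes with negation. It commutes with the existential quantifier because
    the encounter at a given time is unique, and with the universal one because only finitely many
    times matter. *)
Lemma hit_rel_exists S : generic S -> locally_finite S ->
  exists H, hit_rel S H.
Proof.
move=> genS lfS.
have [G [GU Ginf]] := @ultraFilterLemma nat \oo _.
pose e n : R := n.+1%:R^-1.
have e0 n : 0 < e n by rewrite invr_gt0.
pose A n g s t := delayed_hit S (e n) (Num.truncn (t / e n)).+1 g s t.
have tA n t : t < e n * (Num.truncn (t / e n)).+1%:R.
  by rewrite mulrC -ltr_pdivrMr// truncnS_gt.
(* With enough fuel, [A n] satisfies the hit equation with delay [e n]. *)
have AE n g s t : A n g s t <-> exists h s' b, meet S g s t h s' b /\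
    forall r, 0 <= r -> r + e n < b -> ~ A n h s' r.
  have fuelE h s' r : r + e n < t ->
      delayed_hit S (e n) (Num.truncn (t / e n)) h s' r <-> A n h s' r.
    move=> ret; apply: delayed_hit_fuel => //.
    by have := tA n t; rewrite -natr1 mulrDr mulr1; lra.
  rewrite {1}/A /=; split=> -[h [s' [b [me nH]]]]; exists h, s', b;
      split=> // r r0 reb Hr; apply: (nH r) => //; apply/fuelE => //;
      by case: me => _ _ /andP[_ bt] _; apply: lt_le_trans bt.
exists (fun g s t => G [set n | A n g s t]) => g s t Sg; split=> [GA|].
  have [n0 /= An0] := @filter_ex _ _ _ _ GA.
  have [h [s' [b [me _]]]] := (AE _ _ _ _).1 An0.
  exists h, s', b; split => // r /andP[r0 rb] GAr.
  (* A delay shorter than [b - r] lets the hit at [r] be noticed before [b]. *)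
  have Ge : G [set n | r + e n < b].
    apply: Ginf; near=> n => /=; rewrite -ltrBrDl.
    by near: n; apply: near_infty_natSinv_lt (PosNum _); rewrite subr_gt0.
  have [n [[/= A1 A2] A3]] := @filter_ex _ _ _ _ (filterI (filterI GA GAr) Ge).
  have [h' [s'' [b' [me' nA]]]] := (AE _ _ _ _).1 A1.
  have [hE sE bE] := meet_uniq genS Sg me me'; subst h' s'' b'.
  exact: (nA r).
case=> [h [s' [b [me nG]]]].
have Sh : S h by case: me.
(* All hits of [h] up to [b], for every index [n], occur at times in this one finite set. *)
pose F := [set r | r <= b /\ exists h1 s1 b1, meet S h s' r h1 s1 b1].
have [X FX] : exists X : {fset R}, F = [set` X].
  by apply/finite_fsetP/meet_times_finite.
have : G (\bigcap_(r in [set` X]) [set n | r < b -> ~ A n h s' r]).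
  apply: filter_bigI => r rX.
  have [rb|] := boolP (r < b); last first.
    by move=> /negP nrb; apply: filterE => n rb.
  have [GA|] := in_ultra_setVsetC [set n | A n h s' r] GU; last first.
    by apply: filterS => n /= nA _.
  have [n0 /= An0] := @filter_ex _ _ _ _ GA.
  have [h1 [s1 [b1 [me1 _]]]] := (AE _ _ _ _).1 An0.
  by case: (nG r) => //; rewrite rb (meet_ge0 me1).
apply: filterS => n /= nA; apply/AE; exists h, s', b; split=> // r r0 reb Ar.
have rb : r < b by apply: lt_trans reb; rewrite ltrDl.
apply: (nA r) => //=.
have : F r.
  split; first exact: ltW.
  by have [h1 [s1 [b1 [? _]]]] := (AE _ _ _ _).1 Ar; exists h1, s1, b1.
by rewrite FX.
Unshelve. all: by end_near. Qed.

Lemma gilbertP S : generic S -> locally_finite S ->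
  gilbert_evolution S (gilbert S).
Proof.
move=> genS lfS; rewrite /gilbert.
have [H HH] := hit_rel_exists genS lfS.
by apply: (@xgetPex _ _ [set tau | gilbert_evolution S tau]);
  eexists; exact: evolution_of_hit_rel HH.
Qed.

End dynamics.

(** * Blocks and shields *)

Section barriers.
Context {R : realType}.
Variables (S : set (germ R)) (tau : stop_times R).
Hypotheses (genS : generic S) (evo : gilbert_evolution S tau).
Implicit Types (g h k c : germ R) (s : bool) (t b r : R).

Lemma evolution_ge g s b : S g ->
  (forall r, 0 <= r < b -> ~ hits S tau g s r) -> (b%:E <= tau g s)%E.
Proof.
move=> Sg nh; have := evo s Sg; case: (tau g s) => [t [t0 ht _]||//].
  rewrite lee_fin leNgt; apply/negP => tb.
  by apply: (nh t) ht; rewrite t0.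
by rewrite leey.
Qed.

Lemma evolution_le g s t : S g -> 0 <= t -> hits S tau g s t ->
  (tau g s <= t%:E)%E.
Proof.
move=> Sg t0 ht; have := evo s Sg; case: (tau g s) => [u [u0 _ nu]|nu|//].
  rewrite lee_fin leNgt; apply/negP => tu.
  by apply: (nu t) ht; rewrite t0.
by case: (nu t t0).
Qed.

Definition rel_along g h : R := axis g.2 h.1 - axis g.2 g.1.
Definition rel_trans g h : R := axis (~~ g.2) h.1 - axis (~~ g.2) g.1.

Lemma hits_rel g f s t : S g -> f.2 = g.2 -> S f -> hits S tau f s t <->
  exists h s' b, [/\ S h, h.2 = ~~ g.2,
    rel_along g h = rel_along g f + (-1) ^+ s * t,
    rel_trans g f = rel_trans g h + (-1) ^+ s' * b &
    0 <= b <= t /\ (b%:E <= tau h s')%E].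
Proof.
move=> Sg fg Sf; rewrite hits_meet.
split=> -[h [s' [b]]] => [[/(meetP _ _ _ _ _ genS Sf)[Sh hf bt e1 e2] btau]|].
  exists h, s', b; rewrite /rel_along /rel_trans -fg -hf; split=> //.
    by rewrite e1; lra.
  by rewrite e2; lra.
rewrite /rel_along /rel_trans -fg => -[Sh hf e1 e2 [bt btau]].
exists h, s', b; split=> //; apply/(meetP _ _ _ _ _ genS Sf); split=> //.
  by lra.
by rewrite hf; lra.
Qed.

Lemma hits_rel_orth g k s t : S g -> k.2 = ~~ g.2 -> S k -> hits S tau k s t <->
  exists h s' b, [/\ S h, h.2 = g.2,
    rel_trans g h = rel_trans g k + (-1) ^+ s * t,
    rel_along g k = rel_along g h + (-1) ^+ s' * b &
    0 <= b <= t /\ (b%:E <= tau h s')%E].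
Proof.
move=> Sg kg Sk; rewrite hits_meet.
split=> -[h [s' [b]]] => [[/(meetP _ _ _ _ _ genS Sk)[Sh]]|].
  rewrite kg negbK => hg bt e1 e2 btau.
  exists h, s', b; rewrite /rel_along /rel_trans; split=> //.
    by rewrite e1; lra.
  by rewrite -hg e2; lra.
rewrite /rel_along /rel_trans => -[Sh hg e1 e2 [bt btau]].
exists h, s', b; split=> //; apply/(meetP _ _ _ _ _ genS Sk).
by rewrite kg negbK hg; split=> //; lra.
Qed.

(** The germ [h] needs less than [a] to reach the line of [g], whose tip needs at least [a] to get
    there. Within that time only a germ parallel to [g], closer than [a] to [h] along [g], could
    stop [h]. The boolean selects the ray of [g] pointing towards [h]. *)
Lemma stopped_by_block a g h : S g -> S h -> h.2 = ~~ g.2 ->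
  0 <= rel_trans g h < a -> a <= `|rel_along g h| ->
  (forall k, S k -> k.2 = g.2 -> `|rel_along g k - rel_along g h| < a ->
     0 < rel_trans g k < a -> False) ->
  (tau g (rel_along g h < 0)%R <= `|rel_along g h|%:E)%E.
Proof.
move=> Sg Sh hg /andP[y0 ya] xa emp.
have gg0 : rel_along g g = 0 /\ rel_trans g g = 0.
  by rewrite /rel_along /rel_trans !subrr.
apply: evolution_le => //; apply/(hits_rel _ _ Sg erefl Sg).
exists h, true, (rel_trans g h); rewrite gg0.1 gg0.2 add0r; split=> //.
- by case: ltP => x0; [rewrite ltr0_norm|rewrite ger0_norm] => //; lra.
- by lra.
split; first by rewrite y0 (le_trans (ltW ya)).
apply: evolution_ge => // r /andP[r0 ry] /(hits_rel_orth _ _ Sg hg Sh).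
case=> k [s' [b [Sk kg e1 e2 [/andP[b0 br] _]]]].
apply: (emp k Sk kg); last by lra.
rewrite e2 opprD addrA subrr sub0r normrN normrM normr_sign mul1r ger0_norm//.
lra.
Qed.

(* A perpendicular ray coming from outside starts at distance at least [2 a], so
   that it reaches the level of a shield after time [a], when the shield already
   spans its column. *)
Lemma sheltered a N g : 0 < a -> S g ->
  (forall i, (i < N)%N ->
     (exists c, [/\ S c, c.2 = g.2, i%:R * a <= rel_along g c < i.+1%:R * a &
                    0 < rel_trans g c < a]) /\
     (exists c, [/\ S c, c.2 = g.2, i%:R * a <= rel_along g c < i.+1%:R * a &
                    - a <= rel_trans g c < 0])) ->
  (forall i k, (i < N)%N -> S k -> k.2 = ~~ g.2 ->
     i%:R * a <= rel_along g k < i.+1%:R * a ->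
     - (2 * a) <= rel_trans g k < 2 * a -> False) ->
  ((N%:R * a)%:E <= tau g false)%E.
Proof.
move=> a0 Sg shield emp.
have gg0 : rel_along g g = 0 /\ rel_trans g g = 0.
  by rewrite /rel_along /rel_trans !subrr.
apply: evolution_ge => // r /andP[r0 rN] /(hits_rel _ _ Sg erefl Sg).
rewrite gg0.1 gg0.2 add0r expr0 mul1r.
case=> k [s' [b [Sk kg e1 e2 [/andP[b0 br] btau]]]].
(* The column containing the tip at the supposed hitting time. *)
pose i := Num.truncn (r / a).
have /andP[ir ri] : i%:R * a <= r < i.+1%:R * a.
  by rewrite -ler_pdivlMr// -ltr_pdivrMr// truncn_itv// divr_ge0// ltW.
have iN : (i < N)%N.
  by rewrite -(ltr_nat R) -(ltr_pM2r a0); apply: le_lt_trans rN.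
(* A shield reaches abscissa [r] within time [a]. A perpendicular ray crossing it by then would
   start in column [i], at height less than [2 * a] in absolute value, where there is no such
   germ. *)
have shield_ge c : S c -> c.2 = g.2 ->
    i%:R * a <= rel_along g c < i.+1%:R * a -> - a <= rel_trans g c < a ->
    (`|r - rel_along g c|%:E <= tau c (r < rel_along g c)%R)%E.
  move=> Sc cg /andP[ic ci] /andP[ac ca].
  apply: evolution_ge => // q /andP[q0 qe] /(hits_rel _ _ Sg cg Sc).
  case=> m [s'' [b' [Sm mg f1 f2 [/andP[b'0 b'q] _]]]].
  have qa : q < a.
    have : `|r - rel_along g c| < a.
      by rewrite -natr1 in ci ri; rewrite ltr_norml; apply/andP; split; lra.
    exact: lt_trans.
  apply: (emp i m iN Sm mg).
    rewrite f1; case: (ltP r) qe => rc; [rewrite ltr0_norm|rewrite ger0_norm];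
      rewrite ?expr1 ?expr0; lra.
  by case: s'' f2; rewrite ?expr1 ?expr0; lra.
have hit_shield c s : S c -> c.2 = g.2 ->
    i%:R * a <= rel_along g c < i.+1%:R * a -> - a <= rel_trans g c < a ->
    `|r - rel_along g c| <= (-1) ^+ s * (rel_trans g c - rel_trans g k) ->
    (tau k s <= ((-1) ^+ s * (rel_trans g c - rel_trans g k))%:E)%E.
  move=> Sc cg ic ac le; apply: evolution_le => //.
    exact: le_trans le.
  apply/(hits_rel_orth _ _ Sg kg Sk).
  exists c, (r < rel_along g c)%R, `|r - rel_along g c|; split => //.
  - by rewrite mulrA -signr_addb addbb mul1r; lra.
  - rewrite e1; case: ltP => rc; [rewrite ltr0_norm|rewrite ger0_norm];
      rewrite ?expr1 ?expr0; lra.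
  - by rewrite normr_ge0 le; split=> //; exact: shield_ge.
have near c : i%:R * a <= rel_along g c < i.+1%:R * a ->
    `|r - rel_along g c| < a.
  move=> /andP[ic ci]; rewrite -natr1 in ci ri.
  by rewrite ltr_norml; apply/andP; split; lra.
have [[c1 [S1 g1 x1 y1]] [c2 [S2 g2 x2 y2]]] := shield i iN.
(* A germ [k] above comes down and stops at the upper shield, strictly before the line of [g]; from
   below the lower shield acts. Heights in between are excluded by [emp]. *)
have [up|up] := leP (2 * a) (rel_trans g k).
  have s'1 : s' = true.
    by case: s' e2 {btau} => //; rewrite expr0; lra.
  subst s'; have n1 := near _ x1.
  have /(le_trans btau) := hit_shield c1 true S1 g1 x1 ltac:(lra)
    ltac:(rewrite expr1; lra).
  by rewrite lee_fin; rewrite expr1 in e2 *; lra.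
have [dn|dn] := ltP (rel_trans g k) (- (2 * a)).
  have s'1 : s' = false.
    by case: s' e2 {btau} => //; rewrite expr1; lra.
  subst s'; have n2 := near _ x2.
  have /(le_trans btau) := hit_shield c2 false S2 g2 x2 ltac:(lra)
    ltac:(rewrite expr0; lra).
  by rewrite lee_fin; rewrite expr0 in e2 *; lra.
by apply: (emp i k iN Sk kg); [rewrite e1 ir|rewrite dn].
Qed.

End barriers.

(** * Length of the stopped rays *)

Section length.
Context {R : realType}.
Implicit Types (S : set (germ R)) (g : germ R).

Lemma line_pt_inj g : injective (line_pt g).
Proof.
case: g => [[x y] []] r1 r2 [] /=; rewrite ?mulr1 ?mulr0 ?addr0.
  by move=> /addrI.
by move=> _ /addrI.
Qed.

Lemma ray_line tau g s T : [set r : R | ray tau g s T (line_pt g r)] =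
  [set r | 0 <= (-1) ^+ s * r <= T /\ (((-1) ^+ s * r)%:E <= tau g s)%E].
Proof.
apply/seteqP; split=> r /=.
  move=> [q qT /line_pt_inj <-].
  by rewrite mulrA -signr_addb addbb mul1r.
move=> rT; exists ((-1) ^+ s * r) => //.
by rewrite /tip mulrA -signr_addb addbb mul1r.
Qed.

Lemma measurable_line_length tau g T :
  measurable [set r : R | (ray tau g false T `|` ray tau g true T) (line_pt g r)].
Proof.
have -> : [set r : R | (ray tau g false T `|` ray tau g true T) (line_pt g r)] =
  [set r : R | ray tau g false T (line_pt g r)] `|`
  [set r : R | ray tau g true T (line_pt g r)] by [].
apply: measurableU; rewrite ray_line; apply: is_interval_measurable => x y /=.
  rewrite expr0 !mul1r => -[/andP[x0 _] _] [/andP[_ yT] yt] z /andP[xz zy].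
  rewrite mul1r (le_trans x0)//= (le_trans zy)//; split=> //.
  by apply: le_trans yt; rewrite lee_fin.
rewrite expr1 !mulN1r => -[/andP[_ yT] yt] [/andP[x0 _] _] z /andP[xz zy].
rewrite mulN1r (le_trans x0) ?lerN2//= (le_trans _ yT) ?lerN2//; split=> //.
by apply: le_trans yt; rewrite lee_fin lerN2.
Qed.

(** Bounding every evolution bounds the chosen one, and the two rays then stay within parameters
    [- M] and [M]. *)
Lemma gilbert_length_le S g T M : 0 <= M ->
  (forall tau s, gilbert_evolution S tau -> (tau g s <= M%:E)%E) ->
  (gilbert_length S g T <= (2 * M)%:E)%E.
Proof.
move=> M0 tauM.
have {}tauM s : (gilbert S g s <= M%:E)%E.
  rewrite /gilbert; case: xgetP => [tau _ /tauM //|_].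
  (* Should no evolution exist, the stopping times take the default value [0]. *)
  by rewrite lee_fin.
rewrite /gilbert_length /line_length.
apply: (@le_trans _ _ (lebesgue_measure `[- M, M]%classic)).
  apply: le_measure; rewrite ?inE//; first exact: measurable_line_length.
  move=> r [|] /=; rewrite in_itv/=.
    move=> h; have : [set r : R | ray (gilbert S) g false T (line_pt g r)] r by [].
    rewrite ray_line/= expr0 mul1r => -[/andP[r0 _] rt].
    by have := le_trans rt (tauM _); rewrite lee_fin; lra.
  move=> h; have : [set r : R | ray (gilbert S) g true T (line_pt g r)] r by [].
  rewrite ray_line/= expr1 mulN1r => -[/andP[r0 _] rt].
  by have := le_trans rt (tauM _); rewrite lee_fin; lra.
rewrite lebesgue_measure_itv/=; case: ifPn => _; last by rewrite lee_fin mulr_ge0.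
by rewrite EFinN -EFinB lee_fin; lra.
Qed.

(** The positive ray alone covers the parameters from [0] to the minimum of [T] and [M]. *)
Lemma gilbert_length_gt S g t T M : 0 < t -> t < T -> t < M ->
  (M%:E <= gilbert S g false)%E -> (t%:E < gilbert_length S g T)%E.
Proof.
move=> t0 tT tM Mtau; pose m := Num.min T M.
have tm : t < m by rewrite lt_min tT.
apply: (@lt_le_trans _ _ (lebesgue_measure `[0, m]%classic)).
  rewrite lebesgue_measure_itv/= lte_fin (lt_trans t0 tm).
  by rewrite -EFinB lte_fin subr0.
rewrite /gilbert_length /line_length.
apply: le_measure; rewrite ?inE//; first exact: measurable_line_length.
move=> r; rewrite /= in_itv/= => /andP[r0 rm]; left.
suff : [set r : R | ray (gilbert S) g false T (line_pt g r)] r by [].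
rewrite ray_line/= expr0 mul1r r0.
move: rm; rewrite le_min => /andP[-> rM]; split=> //.
by apply: le_trans Mtau; rewrite lee_fin.
Qed.

End length.

(** * Points with independent directions *)

Section general_probability.
Context d (Omega : measurableType d) {R : realType} (P : probability Omega R).
Implicit Types (A B N : set Omega).

Lemma measure_eq_off_negligible A B N : measurable A -> measurable B ->
  P.-negligible N -> (forall w, ~ N w -> A w <-> B w) -> P A = P B.
Proof.
move=> mA mB [N' [mN' N'0 NN']] AB.
have sub X Y : measurable X -> measurable Y ->
    (forall w, ~ N w -> X w -> Y w) -> (P X <= P Y)%E.
  move=> mX mY XY; apply: (@le_trans _ _ (P (Y `|` N'))).
    apply: le_measure; rewrite ?inE//; first exact: measurableU.
    move=> w Xw; have [/NN'|nN] := pselect (N w); first by right.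
    by left; exact: XY.
  have := measureU2 P mY mN'.
  by move: N'0 => /= ->; rewrite adde0.
by apply/eqP; rewrite eq_le !sub// => w /AB[].
Qed.

Lemma measure_bigcup_scale (F G : nat -> set Omega) (c : R) :
  (forall n, measurable (F n)) -> (forall n, measurable (G n)) ->
  trivIset setT F -> trivIset setT G -> (forall n, P (F n) = P (G n) * c%:E)%E ->
  P (\bigcup_n F n) = (P (\bigcup_n G n) * c%:E)%E.
Proof.
move=> mF mG tF tG FG; rewrite !measure_bigcup//.
rewrite muleC -nneseriesZl//.
by apply: eq_eseriesr => n _; apply: etrans (FG n) (muleC _ _).
Qed.

Lemma mutually_independent_seq (I : choiceType) (F : I -> set (set Omega))
    (s : seq I) (E : I -> set Omega) : mutually_independent P F -> uniq s ->
  (forall i, i \in s -> F i (E i)) ->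
  P (\bigcap_(i in [set` s]) E i) = (\prod_(i <- s) P (E i))%E.
Proof.
move=> indep us FE.
have := indep [fset x in s]%fset E.
have -> : [set` [fset x in s]%fset] = [set` s].
  by apply/seteqP; split => x /=; rewrite !inE.
move=> ->; last by move=> i; rewrite !inE; exact: FE.
apply: perm_big; apply: uniq_perm => // x.
by rewrite !inE.
Qed.

Lemma negligible_of_small N (C : R) :
  (forall n, exists A, [/\ measurable A, N `<=` A &
     (P A <= (C / n.+1%:R)%:E)%E]) -> P.-negligible N.
Proof.
move=> /choice[A AP].
have mA n : measurable (A n) by case: (AP n).
exists (\bigcap_n A n); split; last by move=> w Nw n _; case: (AP n) => _ /(_ w Nw).
  exact: bigcapT_measurable.
apply/eqP; rewrite eq_le measure_ge0 andbT; apply/lee_addgt0Pr => e e0.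
rewrite add0e.
pose n := Num.truncn (C / e).
apply: (@le_trans _ _ (P (A n))).
  apply: le_measure; rewrite ?inE//; first exact: bigcapT_measurable.
  by move=> w; exact.
have [_ _ /le_trans] := AP n; apply; rewrite lee_fin.
by rewrite ler_pdivrMr// mulrC -ler_pdivrMr// ltW// truncnS_gt.
Qed.

End general_probability.

(** * Probabilities of cell patterns with prescribed directions *)

Section marked_events.
Context d (Omega : measurableType d) {R : realType} (P : probability Omega R).
Variables (U : nat -> {RV P >-> (R * R)%type}) (D : nat -> {RV P >-> bool}).
Hypothesis D_fair : forall n b, P (D n @^-1` [set b]) = (2^-1)%:E.
Hypothesis D_indep : mutually_independent P (fun o : option nat =>
  if o is Some n then sigma_of (D n) else <<s \bigcup_n sigma_of (U n) >>).
Implicit Types (B : set (R * R)) (F G : set Omega) (n : nat) (b : bool).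

Let sU := \bigcup_n sigma_of (U n).

Definition empty_ev B : set Omega := [set w | forall n, ~ B (U n w)].

(** Uniqueness is that of the index, so that the event singles out the coin [D n]. *)
Definition single_ev B n : set Omega :=
  [set w | B (U n w) /\ forall m, B (U m w) -> m = n].

(** Forgets the direction prescribed by [mark_ev], leaving an event about the points alone. *)
Definition count_ev B (o : option bool) : set Omega :=
  if o is Some _ then \bigcup_n single_ev B n else empty_ev B.

Definition mark_ev B (o : option bool) : set Omega :=
  if o is Some b then \bigcup_n (single_ev B n `&` D n @^-1` [set b])
  else empty_ev B.

Lemma sigma_sub_measurable F : <<s sU >> F -> measurable F.
Proof.
apply: smallest_sub; first exact: sigma_algebra_measurable.
move=> _ [n _ [B mB <-]]; exact: measurable_funP.
Qed.

Lemma sigma_preimage n B : measurable B -> <<s sU >> (U n @^-1` B).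
Proof.
by move=> mB; apply: sub_sigma_algebra; exists n => //; exists B => //; rewrite setTI.
Qed.

Lemma sigma_setI F G : <<s sU >> F -> <<s sU >> G -> <<s sU >> (F `&` G).
Proof. exact: (@measurableI _ (g_sigma_algebraType sU)). Qed.

Lemma sigma_empty_ev B : measurable B -> <<s sU >> (empty_ev B).
Proof.
move=> mB.
have -> : empty_ev B = \bigcap_n U n @^-1` (~` B).
  by apply/seteqP; split => w /= nB n; [move=> _; exact: nB|exact: nB].
apply: (@bigcapT_measurable _ (g_sigma_algebraType sU)) => n.
by apply: sigma_preimage; exact: measurableC.
Qed.

Lemma sigma_single_ev B n : measurable B -> <<s sU >> (single_ev B n).
Proof.
move=> mB.
have -> : single_ev B n = U n @^-1` B `&`
    \bigcap_(m in [set m | m <> n]) U m @^-1` (~` B).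
  apply/seteqP; split => w [Bn nB]; split => // m; first by move=> mn /nB.
  by move=> Bm; apply: contrapT => mn; exact: (nB m mn).
apply: sigma_setI; first exact: sigma_preimage.
apply: (@bigcap_measurableType _ (g_sigma_algebraType sU)) => m _.
by apply: sigma_preimage; exact: measurableC.
Qed.

Lemma sigma_count_ev B o : measurable B -> <<s sU >> (count_ev B o).
Proof.
move=> mB; case: o => [b|] /=; last exact: sigma_empty_ev.
by apply: sigma_algebra_bigcup => n; exact: sigma_single_ev.
Qed.

Lemma measurable_direction n b : measurable (D n @^-1` [set b]).
Proof. exact: measurable_funPTI. Qed.

Lemma measurable_mark_ev B o : measurable B -> measurable (mark_ev B o).
Proof.
move=> mB; case: o => [b|] /=; last exact: (sigma_sub_measurable (sigma_empty_ev _)).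
apply: bigcupT_measurable => n; apply: measurableI.
  exact: (sigma_sub_measurable (sigma_single_ev _ _)).
exact: measurable_direction.
Qed.

Lemma trivIset_single_ev B (G : nat -> set Omega) :
  (forall n, G n `<=` single_ev B n) -> trivIset setT G.
Proof.
move=> GB n m _ _ [w [/GB[Bn _] /GB[_]]]; exact.
Qed.

(** In the independent family, [None] carries the event about the points and [Some n] the coin of
    index [n]. *)
Lemma directions_prob F (K : seq nat) (beta : nat -> bool) :
  <<s sU >> F -> uniq K ->
  P (F `&` [set w | forall n, n \in K -> D n w = beta n]) =
  (P F * ((2^-1) ^+ size K)%:E)%E.
Proof.
move=> sF uK.
pose E (o : option nat) := if o is Some n then D n @^-1` [set beta n] else F.
have := @mutually_independent_seq _ _ _ P _ _ (None :: map Some K) E D_indep.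
have Some_inj : injective (@Some nat) by move=> ? ? [].
rewrite /= map_inj_uniq// uK andbT.
have -> : None \notin [seq Some i | i <- K] by apply/mapP => -[].
have -> : \bigcap_(i in [set` None :: [seq Some i | i <- K]]) E i =
    F `&` [set w | forall n, n \in K -> D n w = beta n].
  apply/seteqP; split => w.
    move=> wE; split; first by apply: (wE None); rewrite /= inE.
    by move=> n nK; apply: (wE (Some n)); rewrite /= inE mem_map// nK orbT.
  by move=> [Fw Dw] [n|] //=; rewrite inE /= mem_map//; exact: Dw.
move=> ->//; last first.
  move=> [n _|_] //; exists [set beta n] => //; by rewrite setTI.
rewrite big_cons big_map; congr (_ * _)%E.
under eq_bigr do rewrite D_fair.
by rewrite prodEFin big_const_seq count_predT iter_mulr_1.
Qed.

(* Conditioning on the random index of the point of a cell makes its direction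
   one of countably many independent coin flips; [K] lists the coins that have
   been revealed so far. *)
Lemma marks_prob_rec (I : eqType) (C : I -> set (R * R))
    (o : I -> option bool) F (K : seq nat) (beta : nat -> bool) (s : seq I) :
  (forall i, measurable (C i)) -> trivIset setT C ->
  uniq s -> uniq K -> <<s sU >> F ->
  (forall w, F w -> forall n i, n \in K -> i \in s -> ~ C i (U n w)) ->
  P (F `&` [set w | forall n, n \in K -> D n w = beta n] `&`
     \bigcap_(i in [set` s]) mark_ev (C i) (o i)) =
  (P (F `&` \bigcap_(i in [set` s]) count_ev (C i) (o i)) *
   ((2^-1) ^+ (size K + count (isSome \o o) s))%:E)%E.
Proof.
move=> mC tC; elim: s F K beta => [|c s IH] F K beta /=.
  move=> _ uK sF _; rewrite !set_nil !bigcap_set0 !setIT addn0.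
  exact: directions_prob.
move=> /andP[cs us] uK sF FK.
have capE (G : I -> set Omega) : \bigcap_(i in [set` c :: s]) G i =
    G c `&` \bigcap_(i in [set` s]) G i.
  apply/seteqP; split => w.
    move=> wG; split; first by apply: wG; rewrite /= mem_head.
    by move=> i /= si; apply: wG; rewrite /= inE si orbT.
  by move=> [Gc Gs] i /=; rewrite inE => /predU1P[->//|]; exact: Gs.
rewrite !capE; case oc : (o c) => [b|] /=; last first.
  (* An empty cell involves no coin and is absorbed into [F]. *)
  rewrite add0n !setIA -(setIA F) (setIC _ (empty_ev _)) (setIA F).
  apply: IH => //; first by apply: sigma_setI => //; exact: sigma_empty_ev.
  by move=> w [Fw _] n i nK si; apply: (FK w Fw) => //; rewrite inE si orbT.
set M := \bigcap_(i in _) mark_ev _ _; set N := \bigcap_(i in _) count_ev _ _.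
set Dir := [set w | _].
have mM : measurable M.
  apply: fin_bigcap_measurable => // i _; exact: measurable_mark_ev.
have mN : measurable N.
  apply: fin_bigcap_measurable => // i _.
  exact: (sigma_sub_measurable (sigma_count_ev _ _)).
have mF := sigma_sub_measurable sF.
have mDir : measurable Dir.
  have -> : Dir = \bigcap_(n in [set` K]) D n @^-1` [set beta n] by [].
  by apply: fin_bigcap_measurable => // n _; exact: measurable_direction.
have mS n : measurable (single_ev (C c) n).
  exact: (sigma_sub_measurable (sigma_single_ev _ _)).
have -> : F `&` Dir `&` (\bigcup_n (single_ev (C c) n `&` D n @^-1` [set b]) `&` M)
    = \bigcup_n (F `&` Dir `&`
        (single_ev (C c) n `&` D n @^-1` [set b] `&` M)).
  by rewrite -setI_bigcupr -setI_bigcupl.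
have -> : F `&` (\bigcup_n single_ev (C c) n `&` N)
    = \bigcup_n (F `&` (single_ev (C c) n `&` N)).
  by rewrite -setI_bigcupr -setI_bigcupl.
apply: measure_bigcup_scale.
- move=> n; do !apply: measurableI => //; exact: measurable_direction.
- by move=> n; do !apply: measurableI => //.
- by apply: (@trivIset_single_ev (C c)) => n w [_ [[]]].
- by apply: (@trivIset_single_ev (C c)) => n w [_ []].
move=> n; have [nK|nK] := boolP (n \in K).
  (* The point of a revealed index lies outside the cell, so both sides vanish. *)
  have FS : F `&` single_ev (C c) n = set0.
    rewrite -subset0 => w [Fw [Cn _]].
    by apply: (FK w Fw n c nK _ Cn); rewrite mem_head.
  rewrite [X in P X = _](_ : _ = set0); last first.
    by rewrite -subset0 -FS => w [[? _] [[? _] _]].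
  rewrite [X in (P X * _)%E](_ : _ = set0); last first.
    by rewrite -subset0 -FS => w [? [? _]].
  by rewrite measure0 mul0e.
(* A fresh coin joins the revealed ones with the prescribed value [b]. *)
have := IH (F `&` single_ev (C c) n) (n :: K)
  (fun m => if m == n then b else beta m) us.
rewrite /= nK uK -/M -/N addSn -addnS (setIA F _ N) => <- //.
- congr (P _); rewrite setIA; congr (_ `&` M).
  apply/seteqP; split => w.
    move=> [[Fw Dw] [Sw Dnw]]; split => // m; rewrite inE.
    by case: eqVneq => [->//|_ /=]; exact: Dw.
  move=> [[Fw Sw] Dw]; split; split => //.
    move=> m mK; have := Dw m; rewrite inE mK orbT => /(_ isT).
    by case: eqVneq nK => // <-; rewrite mK.
  by have := Dw n; rewrite mem_head eqxx => /(_ isT).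
- by apply: sigma_setI => //; exact: sigma_single_ev.
- move=> w [Fw [Cn _]] m i; rewrite inE => /predU1P[->|mK] si; last first.
    by apply: (FK w Fw) => //; rewrite inE si orbT.
  (* By disjointness, the newly revealed point lies in none of the remaining cells. *)
  move=> Ci; move: cs; have -> : c = i by apply: (tC c i) => //; exists (U n w).
  by rewrite si.
Qed.

Lemma marks_prob (I : eqType) (C : I -> set (R * R))
    (o : I -> option bool) (s : seq I) :
  (forall i, measurable (C i)) -> trivIset setT C -> uniq s ->
  P (\bigcap_(i in [set` s]) mark_ev (C i) (o i)) =
  (P (\bigcap_(i in [set` s]) count_ev (C i) (o i)) *
   ((2^-1) ^+ count (isSome \o o) s)%:E)%E.
Proof.
move=> mC tC us.
have := @marks_prob_rec I C o setT [::] (fun=> true) s mC tC us isT.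
rewrite !setTI add0n => <- //.
- by congr (P _); apply/seteqP; split => w // [].
- exact: (@measurableT _ (g_sigma_algebraType sU)).
Qed.

End marked_events.

(** * Poisson counts and almost sure regularity *)

Section rectangles.
Context {R : realType}.
Implicit Types (d : bool) (x y : R).

(** Half-open on both axes, so that translates tile the plane; the first pair of bounds is along
    direction [d]. *)
Definition rect d x1 x2 y1 y2 : set (R * R) :=
  [set p | x1 <= axis d p < x2 /\ y1 <= axis (~~ d) p < y2].

Lemma rectE d x1 x2 y1 y2 : rect d x1 x2 y1 y2 =
  if d then `[x1, x2[%classic `*` `[y1, y2[%classic
  else `[y1, y2[%classic `*` `[x1, x2[%classic.
Proof.
by case: d; apply/seteqP; split => -[x y] /=;
  rewrite /rect /axis /= !in_itv/= => -[].
Qed.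

Lemma measurable_rect d x1 x2 y1 y2 : measurable (rect d x1 x2 y1 y2).
Proof. by rewrite rectE; case: d; apply: measurableX. Qed.

Lemma area_rect d x1 x2 y1 y2 : x1 < x2 -> y1 < y2 ->
  area (rect d x1 x2 y1 y2) = ((x2 - x1) * (y2 - y1))%:E.
Proof.
move=> x12 y12; rewrite /area rectE.
have len (a b : R) : a < b -> lebesgue_measure `[a, b[%classic = (b - a)%:E.
  by move=> ab; rewrite lebesgue_measure_itv/= lte_fin ab -EFinB.
case: d; rewrite product_measure1E//;
  apply: etrans (congr2 _ (len _ _ _) (len _ _ _)) _;
  by rewrite // -EFinM // mulrC.
Qed.

Lemma area_strip d (c e L : R) : 0 < e -> 0 < L ->
  area (rect d c (c + e) (- L) L) = (e * (2 * L))%:E.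
Proof.
move=> e0 L0; rewrite area_rect ?ltrDl//; last by lra.
by congr _%:E; ring.
Qed.

End rectangles.

Section poisson.
Context d (Omega : measurableType d) {R : realType} (P : probability Omega R).
Variables (U : nat -> {RV P >-> (R * R)%type}) (lambda : R).
Hypotheses (lambda0 : 0 < lambda)
  (U_inj : {ae P, forall w, injective (fun n => U n w)})
  (U_poisson : poisson_process P lambda (point_set U)).
Implicit Types (B : set (R * R)).

Let V := point_set U.

Lemma count_event0 B : count_event V B 0 = empty_ev U B.
Proof.
apply/seteqP; split => w; rewrite /count_event /= II0 card_eq0.
  move=> /eqP VB n Bn; suff : (V w `&` B) (U n w) by rewrite VB.
  by split => //; exists n.
move=> nB; apply/eqP; rewrite -subset0 => _ [[n _ <-]]; exact: nB.
Qed.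

(** Points are compared rather than indices, so the identity, and with it measurability, holds for
    every outcome, even if the enumeration repeats a point. *)
Lemma count_event1 B : count_event V B 1 =
  \bigcup_n (U n @^-1` B `&`
    \bigcap_m (U m @^-1` (~` B) `|` [set w | U m w = U n w])).
Proof.
apply/seteqP; split => w; rewrite /count_event /=.
  rewrite card_eq_sym => /card_set_bijP[f [fV finj fsurj]].
  have [[n _ nf0] Bf0] : (V w `&` B) (f 0%N) by exact: fV.
  exists n => //; split; first by rewrite /= nf0.
  move=> m _ /=; have [Bm|] := pselect (B (U m w)); last by left.
  right; have : (V w `&` B) (U m w) by split => //; exists m.
  by move=> /fsurj[[|//] _ <-].
move=> [n _ [Bn nB]].
have -> : V w `&` B = [set U n w]; last exact: card_set1.
apply/seteqP; split => [_ [[m _ <-]] Bm|_ ->]; last by split=> //; exists n.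
by case: (nB m).
Qed.

Lemma measurable_same_point n m : measurable [set w | U m w = U n w].
Proof.
have m0 (f g : {RV P >-> (R * R)%type}) (h : R * R -> R) :
    measurable_fun setT h ->
    measurable ((fun w => h (f w) - h (g w)) @^-1` [set 0]).
  move=> mh; rewrite -[X in measurable X]setTI; apply: measurable_funB => //;
    exact: measurableT_comp.
have -> : [set w | U m w = U n w] =
    (fun w => (U m w).1 - (U n w).1) @^-1` [set 0] `&`
    (fun w => (U m w).2 - (U n w).2) @^-1` [set 0].
  apply/seteqP; split => w /= => [->|[]]; first by rewrite !subrr.
  move=> /eqP; rewrite subr_eq0 => /eqP e1 /eqP; rewrite subr_eq0 => /eqP e2.
  by move: e1 e2; case: (U m w) (U n w) => [? ?] [? ?] /= -> ->.
by apply: measurableI; apply: m0.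
Qed.

Lemma measurable_preimage n B : measurable B -> measurable (U n @^-1` B).
Proof. by move=> mB; exact: measurable_funPTI. Qed.

Lemma measurable_count_event0 B : measurable B -> measurable (count_event V B 0).
Proof.
by move=> mB; rewrite count_event0;
  exact: (sigma_sub_measurable (sigma_empty_ev mB)).
Qed.

Lemma measurable_count_event1 B : measurable B -> measurable (count_event V B 1).
Proof.
move=> mB; rewrite count_event1; apply: bigcupT_measurable => n.
apply: measurableI; first exact: measurable_preimage.
apply: bigcapT_measurable => m; apply: measurableU.
  by apply: measurable_preimage; exact: measurableC.
exact: measurable_same_point.
Qed.

Lemma count_event_prob B (a : R) k : measurable B -> 0 < a ->
  area B = a%:E ->
  P (count_event V B k) = (poisson_pmf (lambda * a) k)%:E.
Proof.
move=> mB a0 aB; have [-> //] := U_poisson; last by rewrite aB ltry.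
rewrite aB /poisson_prob /= mulr_gt0// esum_set1//.
by rewrite lee_fin poisson_pmf_ge0.
Qed.

(** Off the null set where the enumeration repeats a point, counting indices is counting points, and
    counts in disjoint sets are independent. *)
Lemma counts_prob (J : countType) (C : J -> set (R * R)) (a : R)
    (o : J -> option bool) (s : seq J) :
  (forall i, measurable (C i)) -> trivIset setT C ->
  0 < a -> (forall i, area (C i) = a%:E) -> uniq s ->
  P (\bigcap_(i in [set` s]) count_ev U (C i) (o i)) =
  (\prod_(i <- s) poisson_pmf (lambda * a) (isSome (o i)))%:E.
Proof.
move=> mC tC a0 aC us.
pose E i := count_event V (C i) (isSome (o i)).
have mE i : measurable (E i).
  rewrite /E; case: (o i) => [b|] /=; first exact: measurable_count_event1.
  exact: measurable_count_event0.
rewrite (@measure_eq_off_negligible _ _ _ P _ (\bigcap_(i in [set` s]) E i) _ _ _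
    U_inj); last 3 first.
- apply: fin_bigcap_measurable => // i _.
  exact: (sigma_sub_measurable (sigma_count_ev _ (mC i))).
- exact: fin_bigcap_measurable.
- move=> w /contrapT Uw.
  suff EC i : count_ev U (C i) (o i) w <-> E i w.
    by split=> wE i si; apply/EC; exact: wE.
  rewrite /E; case: (o i) => [b|] /=; last by rewrite count_event0.
  rewrite count_event1; split=> -[n _ [Bn nB]]; exists n => //; split => //.
    move=> m _ /=; have [/nB->|] := pselect (C i (U m w)); first by right.
    by left.
  by move=> m Bm; have [//|/Uw] := nB m Logic.I.
(* Independence is given for sequences of sets: the cells are renumbered by naturals, with the empty
   set for naturals that encode no cell. *)
pose B (n : nat) := oapp C set0 (@pickle_inv J n).
have mB n : measurable (B n) by rewrite /B; case: (@pickle_inv J n) => [i|] //=.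
have tB : trivIset setT B.
  move=> n m _ _ [p []]; rewrite /B.
  case En : (@pickle_inv J n) => [i|]//=; case Em : (@pickle_inv J m) => [j|]//= Ci Cj.
  have ij : i = j by apply: tC => //; exists p.
  have := @pickle_invK J n; have := @pickle_invK J m.
  by rewrite En Em /= ij => -> ->.
pose E' (n : nat) := if @pickle_inv J n is Some i then E i else setT.
have E'E i : E' (choice.pickle i) = E i by rewrite /E' pickleK_inv.
have [_ /(_ B mB tB) indep] := U_poisson.
have := @mutually_independent_seq _ _ _ P _ _ (map choice.pickle s) E' indep.
have -> : \bigcap_(i in [set` [seq choice.pickle i | i <- s]]) E' i =
    \bigcap_(i in [set` s]) E i.
  apply/seteqP; split => w wE.
    by move=> i si; rewrite -E'E; apply: wE; apply/mapP; exists i.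
  by move=> _ /mapP[i si ->]; rewrite E'E; exact: wE.
move=> ->; last 2 first.
- by rewrite map_inj_uniq//; exact: (pcan_inj (@pickleK J)).
- move=> _ /mapP[i si ->]; rewrite E'E /B pickleK_inv/=.
  by exists (isSome (o i)).
rewrite big_map -prodEFin; apply: eq_bigr => i _.
by rewrite E'E /E (count_event_prob _ (mC i) a0 (aC i)).
Qed.

Definition crowded B : set Omega := ~` (count_event V B 0 `|` count_event V B 1).

Lemma measurable_crowded B : measurable B -> measurable (crowded B).
Proof.
move=> mB; apply: measurableC; apply: measurableU.
  exact: measurable_count_event0.
exact: measurable_count_event1.
Qed.

Lemma crowded_prob B (a : R) : measurable B -> 0 < a -> area B = a%:E ->
  (P (crowded B) <= ((lambda * a) ^+ 2)%:E)%E.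
Proof.
move=> mB a0 aB.
have m0 := measurable_count_event0 mB; have m1 := measurable_count_event1 mB.
rewrite probability_setC; last exact: measurableU.
have disj : count_event V B 0 `&` count_event V B 1 = set0.
  rewrite -subset0 count_event0 count_event1 => w [nB [n _ [Bn _]]].
  exact: (nB n).
have -> : P (count_event V B 0 `|` count_event V B 1) =
    (poisson_pmf (lambda * a) 0 + poisson_pmf (lambda * a) 1)%:E.
  by rewrite measureU// EFinD; congr (_ + _)%E; exact: count_event_prob.
rewrite -EFinB lee_fin.
rewrite /poisson_pmf mulr_gt0// expr0 expr1 fact0 invr1 !mulr1 mul1r.
set u := lambda * a; have u0 : 0 <= u by rewrite mulr_ge0// ltW.
(* From [expR (- u) >= 1 - u] follows [(1 + u) expR (- u) >= 1 - u^2]. *)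
have := expR_ge1Dx (- u); have := expR_gt0 (- u); nra.
Qed.

Lemma nonempty_prob B (a : R) : measurable B -> 0 < a -> area B = a%:E ->
  (P (~` empty_ev U B) <= (lambda * a)%:E)%E.
Proof.
move=> mB a0 aB; rewrite -count_event0.
have m0 := measurable_count_event0 mB.
rewrite probability_setC// (count_event_prob _ mB a0 aB) -EFinB lee_fin.
rewrite /poisson_pmf mulr_gt0// expr0 fact0 invr1 !mulr1 mul1r.
have := expR_ge1Dx (- (lambda * a)); lra.
Qed.

(** Each bounded piece of the line lies in a rectangle of width [1 / (n + 1)], which contains a
    point with probability O(1/n). *)
Lemma line_negligible b (c : R) :
  P.-negligible [set w | exists n, axis b (U n w) = c].
Proof.
have -> : [set w | exists n, axis b (U n w) = c] =
    \bigcup_M [set w | exists n, axis b (U n w) = c /\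
      - M.+1%:R <= axis (~~ b) (U n w) < M.+1%:R].
  apply/seteqP; split => w /= => [[n nc]|[M _ [n [nc _]]]]; last by exists n.
  exists (Num.truncn `|axis (~~ b) (U n w)|) => //=; exists n; split => //.
  have := truncnS_gt `|axis (~~ b) (U n w)|; rewrite ltr_norml.
  by move=> /andP[/ltW -> ->].
apply: negligible_bigcup => M.
apply: (@negligible_of_small _ _ _ _ _ (lambda * (2 * M.+1%:R))) => n.
pose B := rect b c (c + n.+1%:R^-1) (- M.+1%:R) M.+1%:R.
have n0 : 0 < n.+1%:R^-1 :> R by rewrite invr_gt0.
have M0 : 0 < M.+1%:R :> R by [].
have mB : measurable B by exact: measurable_rect.
exists (~` empty_ev U B); split.
- by apply: measurableC; rewrite -count_event0; exact: measurable_count_event0.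
- move=> w /= [m [mc mM]] /(_ m); apply; split => //.
  by rewrite mc lexx ltrDl.
- have aB : area B = (n.+1%:R^-1 * (2 * M.+1%:R))%:E.
    exact: area_strip.
  apply: (le_trans (nonempty_prob mB _ aB)); first by rewrite !mulr_gt0.
  by rewrite lee_fin mulrCA mulrC.
Qed.

Definition window (M : nat) : set (R * R) :=
  rect true (- M.+1%:R) M.+1%:R (- M.+1%:R) M.+1%:R.

Lemma window_axis b M p : window M p -> - M.+1%:R <= axis b p < M.+1%:R.
Proof. by case: b => -[]. Qed.

Lemma in_window M p : (forall b, `|axis b p| < M.+1%:R) -> window M p.
Proof.
move=> pM; split; [have := pM true|have := pM false];
  by rewrite ltr_norml => /andP[/ltW -> ->].
Qed.

(* Cutting the window into n + 1 strips, some strip contains two points with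
   probability O(1/n). *)
Lemma strips_negligible b M : P.-negligible
  [set w | (exists n m, [/\ U n w <> U m w, window M (U n w),
              window M (U m w) & axis b (U n w) = axis b (U m w)]) \/
           infinite_set (V w `&` window M)].
Proof.
pose L : R := M.+1%:R; have L0 : 0 < L by [].
apply: (@negligible_of_small _ _ _ _ _ ((lambda * (4 * L ^+ 2)) ^+ 2)) => N.
(* Each of the [N + 1] strips has area [4 L^2 / (N + 1)]. The squared bound for crowding, summed
   over the strips, leaves one factor [1 / (N + 1)]. *)
pose h : R := 2 * L / N.+1%:R; have h0 : 0 < h by rewrite divr_gt0// mulr_gt0.
pose strip (i : nat) := rect b (- L + i%:R * h) (- L + i%:R * h + h) (- L) L.
have mstrip i : measurable (strip i) by exact: measurable_rect.
have in_strip p : window M p -> exists2 i, (i < N.+1)%N & strip i p.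
  move=> Wp; have /andP[pl pu] := window_axis b Wp.
  have x0 : 0 <= (axis b p + L) / h.
    by apply: divr_ge0; [rewrite -/L in pl; lra|exact: ltW].
  exists (Num.truncn ((axis b p + L) / h)).
    rewrite -(ltr_nat R); have /andP[/le_lt_trans + _] := truncn_itv x0; apply.
    rewrite ltr_pdivrMr// /h mulrCA mulfV ?pnatr_eq0// mulr1.
    rewrite -/L in pu; lra.
  split; last exact: window_axis.
  have := truncn_itv x0.
  set k := Num.truncn _; rewrite -[k.+1%:R]natr1 ler_pdivlMr// ltr_pdivrMr//.
  by rewrite mulrDl mul1r => /andP[? ?]; apply/andP; split; lra.
exists (\big[setU/set0]_(i < N.+1) crowded (strip i)); split.
- by apply: bigsetU_measurable => i _; exact: measurable_crowded.
- move=> w /= h1; apply: contrapT => ncr.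
  (* Without crowded strips, each strip holds at most one point: this rules out equal coordinates
     and makes the window finite. *)
  have sparse i p q : (i < N.+1)%N -> V w p -> V w q -> strip i p -> strip i q ->
      p = q.
    move=> iN Vp Vq ip iq; apply: contrapT => pq; apply: ncr.
    rewrite -(bigcup_mkord _ (fun i => crowded (strip i))); exists i => //.
    rewrite /crowded count_event0 count_event1 => -[|[n _ [/= _ nB]]].
      by case: Vp => n _ np /(_ n); rewrite np.
    apply: pq; case: Vp Vq ip iq => [k _ <-] [l _ <-] ik il.
    by case: (nB k) => [//||->]//; case: (nB l).
  case: h1 => [[n [m [nm Wn Wm e]]]|inf].
    apply: nm; have [i iN [ni nL]] := in_strip _ Wn.
    apply: (sparse i) => //; [by exists n|by exists m|].
    by split; [rewrite -e|exact: window_axis].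
  apply: inf; apply: (@sub_finite_set _ _
      (\bigcup_(i in `I_N.+1) (V w `&` strip i))).
    by move=> p [Vp /in_strip[i iN ip]]; exists i.
  apply: bigcup_finite => // i /= iN.
  have [->//|/set0P[p [Vp ip]]] := eqVneq (V w `&` strip i) set0.
  apply: (@sub_finite_set _ _ [set p]); last exact: finite_set1.
  by move=> q [Vq iq] /=; exact: (sparse i).
- have bnd i : (P (crowded (strip i)) <= ((lambda * (h * (2 * L))) ^+ 2)%:E)%E.
    have hpos : 0 < h * (2 * L) by rewrite !mulr_gt0.
    by apply: (crowded_prob (mstrip i) hpos); exact: area_strip.
  apply: (@le_trans _ _ (\sum_(i < N.+1) P (crowded (strip i)))%E).
    apply: (content_subadditive P (F := fun i => crowded (strip i))) => //.
    + by move=> k _; exact: measurable_crowded.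
    + by apply: bigsetU_measurable => i _; exact: measurable_crowded.
  apply: (@le_trans _ _ (\sum_(i < N.+1) ((lambda * (h * (2 * L))) ^+ 2)%:E)%E).
    by apply: lee_sum => i _.
  rewrite sumEFin lee_fin big_const cardT size_enum_ord iter_addr_0.
  rewrite -mulr_natl /h.
  have N0 : N.+1%:R != 0 :> R by rewrite pnatr_eq0.
  rewrite le_eqVlt; apply/orP; left; apply/eqP.
  by move: N0; set z := N.+1%:R => z0; field.
Qed.

Definition regular (v : R * R) (w : Omega) :=
  [/\ injective (fun n => U n w),
      forall b n m, n <> m -> axis b (U n w) <> axis b (U m w),
      forall b n, axis b (U n w) <> axis b v &
      forall M, finite_set (V w `&` window M)].

Lemma regular_ae v : P.-negligible [set w | ~ regular v w].
Proof.
pose N1 := \bigcup_M [set w | (exists n m, [/\ U n w <> U m w, window M (U n w),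
              window M (U m w) & axis true (U n w) = axis true (U m w)]) \/
           infinite_set (V w `&` window M)].
pose N2 := \bigcup_M [set w | (exists n m, [/\ U n w <> U m w, window M (U n w),
              window M (U m w) & axis false (U n w) = axis false (U m w)]) \/
           infinite_set (V w `&` window M)].
pose L b := [set w | exists n, axis b (U n w) = axis b v].
apply: (@negligibleS _ _ _ _ ((~` [set w | injective (fun n => U n w)] `|`
  (N1 `|` N2)) `|` (L true `|` L false))).
  move=> w nreg; apply: contrapT.
  move=> /not_orP[/not_orP[/contrapT Uw /not_orP[n1 n2]] /not_orP[l1 l2]].
  apply: nreg; split=> //.
  - move=> b n m nm e.
    (* A bound for all coordinates of both points, so that one window contains them. *)
    pose x := \sum_(q <- [:: U n w; U m w]) (`|axis true q| + `|axis false q|).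
    pose M := Num.truncn x.
    have big p : p \in [:: U n w; U m w] -> window M p.
      move=> pin; apply: in_window => c; apply: le_lt_trans (truncnS_gt x).
      rewrite /x (big_rem p pin)/= ler_wpDr//.
        by apply: sumr_ge0 => q _; rewrite addr_ge0.
      by case: c; rewrite ?lerDl ?lerDr.
    have Wn : window M (U n w) by apply: big; rewrite mem_head.
    have Wm : window M (U m w) by apply: big; rewrite !inE eqxx orbT.
    have Unm : U n w <> U m w by move=> /Uw.
    by case: b e => e; [apply: n1|apply: n2]; exists M => //; left; exists n, m.
  - by case=> n e; [apply: l1|apply: l2]; exists n.
  - move=> M; apply: contrapT => inf; apply: n1; exists M => //.
    by right.
apply: negligibleU; last by apply: negligibleU; exact: line_negligible.
apply: negligibleU => //.
by apply: negligibleU; apply: negligible_bigcup => M; exact: strips_negligible.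
Qed.

End poisson.

(** * Independent cell patterns *)

(** Only conjunctions of patterns have a product formula. The list [l] makes the induction work: the
    failure of block [m] is the event for [l] minus that for [blk m ++ l], which yields a factor
    [1 - p]. *)
Lemma blocks_prob d (Omega : measurableType d) (R : realType)
    (P : probability Omega R) (J : eqType) (M : J -> set Omega) (wt : J -> R)
    (blk : nat -> seq J) (p : R) :
  (forall c, measurable (M c)) ->
  (forall s, uniq s -> P (\bigcap_(c in [set` s]) M c) = (\prod_(c <- s) wt c)%:E) ->
  (forall k, uniq (blk k)) ->
  (forall k k' c, c \in blk k -> c \in blk k' -> k = k') ->
  (forall k, \prod_(c <- blk k) wt c = p) ->
  forall m l, uniq l -> (forall k c, (k < m)%N -> c \in blk k -> c \notin l) ->
  P (\bigcap_(k in `I_m) ~` (\bigcap_(c in [set` blk k]) M c) `&`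
     \bigcap_(c in [set` l]) M c) = ((1 - p) ^+ m * \prod_(c <- l) wt c)%:E.
Proof.
move=> mM PM ublk dblk pblk.
have mC (s : seq J) : measurable (\bigcap_(c in [set` s]) M c).
  by apply: fin_bigcap_measurable; [exact: finite_seq|move=> c _; exact: mM].
elim=> [|m IH] l ul ml.
  by rewrite II0 bigcap_set0 setTI expr0 mul1r PM//.
set X := \bigcap_(k in `I_m) ~` (\bigcap_(c in [set` blk k]) M c) in IH *.
have mX : measurable X.
  by apply: fin_bigcap_measurable => // k _; exact: measurableC.
have -> : \bigcap_(k in `I_m.+1) ~` (\bigcap_(c in [set` blk k]) M c) `&`
    \bigcap_(c in [set` l]) M c =
    X `&` \bigcap_(c in [set` l]) M c `\` \bigcap_(c in [set` blk m]) M c.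
  apply/seteqP; split => w.
    move=> [XE lE]; split; last exact: (XE m (ltnSn m)).
    by split=> // k /= km; apply: XE; exact: ltnW.
  move=> [[Xw lE] mE]; split=> // k /=; rewrite ltnS leq_eqVlt.
  by move=> /orP[/eqP ->//|]; exact: Xw.
rewrite measureD//; last 2 first.
- exact: measurableI.
- by rewrite (le_lt_trans (probability_le1 _ _)) ?ltry//; exact: measurableI.
have -> : X `&` \bigcap_(c in [set` l]) M c `&` \bigcap_(c in [set` blk m]) M c =
    X `&` \bigcap_(c in [set` blk m ++ l]) M c.
  rewrite -setIA; congr (_ `&` _); apply/seteqP; split => w /=.
    by move=> [wl wm] c /=; rewrite mem_cat => /orP[]; [exact: wm|exact: wl].
  by move=> wc; split=> c /= cs; apply: wc; rewrite /= mem_cat cs ?orbT.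
have E1 := IH l ul (fun k c km => ml k c (ltnW km)).
have E2 : P (X `&` \bigcap_(c in [set` blk m ++ l]) M c) =
    ((1 - p) ^+ m * (p * \prod_(c <- l) wt c))%:E.
  rewrite IH ?big_cat ?pblk//.
    rewrite cat_uniq ublk ul andbT; apply/hasPn => c cl; apply/negP => cm.
    by have := ml m c (ltnSn m) cm; rewrite cl.
  move=> k c km ck; rewrite mem_cat negb_or (ml k c (ltnW km) ck) andbT.
  by apply/negP => cm; move: km; rewrite (dblk k m c)// ltnn.
move: E1 E2 => /= -> ->.
by rewrite -EFinB; congr _%:E; rewrite exprS; ring.
Qed.

(** * The grid around [v] and the two patterns *)

Section grid.
Context d (Omega : measurableType d) {R : realType} (P : probability Omega R).
Variables (lambda : R) (U : nat -> {RV P >-> (R * R)%type})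
  (D : nat -> {RV P >-> bool}) (v : R * R) (dv : bool).
Hypotheses (lambda0 : 0 < lambda) (UD : poisson_germs lambda U D).

Let a := (Num.sqrt lambda)^-1.

Let a0 : 0 < a. Proof. by rewrite invr_gt0 sqrtr_gt0. Qed.

Let lambda_area : lambda * (a * a) = 1.
Proof.
rewrite /a -[in X in X * _](sqr_sqrtr (ltW lambda0)) expr2.
have s0 : Num.sqrt lambda != 0 by rewrite gt_eqF// sqrtr_gt0.
by field.
Qed.

(** The point [v] is a common corner of four cells, and the line of [v] separates rows [-1] and [0].
    The first index runs along that line. *)
Definition cell (c : int * int) : set (R * R) :=
  rect dv (axis dv v + c.1%:~R * a) (axis dv v + c.1%:~R * a + a)
    (axis (~~ dv) v + c.2%:~R * a) (axis (~~ dv) v + c.2%:~R * a + a).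

Lemma measurable_cell c : measurable (cell c).
Proof. exact: measurable_rect. Qed.

Lemma area_cell c : area (cell c) = (a * a)%:E.
Proof.
rewrite area_rect; first by congr _%:E; ring.
  by rewrite ltrDl.
by rewrite ltrDl.
Qed.

Lemma trivIset_cell : trivIset setT cell.
Proof.
move=> [i j] [i' j'] _ _ [p [[/andP[x1 x2] /andP[y1 y2]]]].
move=> [/andP[x3 x4] /andP[y3 y4]] /=.
have lt_of (k l : int) (z c : R) : c + k%:~R * a <= z -> z < c + l%:~R * a + a ->
    (k <= l)%R.
  move=> kz zl; rewrite -ltzD1 -(ltr_int R) -(ltr_pM2r a0) rmorphD/= mulrDl mul1r.
  lra.
congr (_, _); apply/eqP; rewrite eq_le.
  by rewrite (lt_of _ _ _ _ x1 x4) (lt_of _ _ _ _ x3 x2).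
by rewrite (lt_of _ _ _ _ y1 y4) (lt_of _ _ _ _ y3 y2).
Qed.

Let q : R := expR (-1).

(** A Poisson variable of mean 1 takes the values 0 and 1 with the same probability [expR (-1)]; a
    prescribed direction costs a further factor 1/2. *)
Definition weight (o : option bool) : R := if o is Some _ then q / 2 else q.

Lemma cells_prob (o : int * int -> option bool) s : uniq s ->
  P (\bigcap_(c in [set` s]) mark_ev U D (cell c) (o c)) =
  (\prod_(c <- s) weight (o c))%:E.
Proof.
move=> us; have [Uinj Upois Dfair Dind] := UD.
rewrite (marks_prob Dfair Dind o measurable_cell trivIset_cell us).
have aa0 : 0 < a * a by rewrite mulr_gt0.
rewrite (counts_prob lambda0 Uinj Upois o measurable_cell trivIset_cell aa0 area_cell us).
rewrite -EFinM; congr _%:E; rewrite lambda_area.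
have pmf1 k : (k <= 1)%N -> poisson_pmf 1 k = q.
  by case: k => [|[|//]] _; rewrite /poisson_pmf ltr01 expr1n invr1 !mul1r.
elim: s {us} => [|c s IH]; first by rewrite !big_nil mulr1.
rewrite !big_cons /= exprD mulrACA IH; congr (_ * _).
rewrite pmf1; last by case: (o c).
by case: (o c) => [b|] /=; rewrite ?expr1 ?expr0 ?mulr1.
Qed.

Lemma measurable_cell_mark o c : measurable (mark_ev U D (cell c) o).
Proof. by apply: measurable_mark_ev; exact: measurable_cell. Qed.

Let S w := germ_set (fun n => U n) (fun n => D n) w `|` [set (v, dv)].

Lemma regular_generic w : regular U v w -> generic (S w).
Proof.
case=> Uinj axU axv _ g h.
move=> [[n _ <-]|->] [[m _ <-]|->] gh b //=.
- by apply: axU => nm; apply: gh; rewrite nm.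
- by move=> e; apply: (axv b m).
Qed.

Lemma regular_locally_finite w : regular U v w -> locally_finite (S w).
Proof.
case=> _ _ _ fin M.
pose K := Num.truncn `|M|.
apply: (@sub_finite_set _ _ ([set (v, dv)] `|`
  (point_set (fun n => U n) w `&` window K) `*` [set: bool])).
  move=> g [[[n _ <-]|->] gM]; last by left.
  right; split => //; split; first by exists n.
  apply: in_window => b; apply: le_lt_trans (truncnS_gt `|M|).
  exact: (le_trans (gM b) (ler_norm _)).
by rewrite finite_setU; split; [exact: finite_set1|exact: finite_setX].
Qed.

Let along n w := rel_along (v, dv) (U n w, D n w).
Let trans n w := rel_trans (v, dv) (U n w, D n w).

Lemma in_cell i j n w : cell (i, j) (U n w) <->
  (i%:~R * a <= along n w < i%:~R * a + a) /\ (j%:~R * a <= trans n w < j%:~R * a + a).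
Proof.
rewrite /along /trans /rel_along /rel_trans /cell /rect /=.
split=> -[/andP[? ?] /andP[? ?]]; split; apply/andP; split; lra.
Qed.

(** The condition on [i] keeps the blocking point at distance at least [a] from [v] along the line.
    A germ closer than [a] to it along the line, in row [0], lies in one of the three cells. *)
Lemma gap_blocks w tau i : regular U v w -> gilbert_evolution (S w) tau ->
  (1 <= i) || (i <= -2) ->
  mark_ev U D (cell (i, 0)) (Some (~~ dv)) w ->
  mark_ev U D (cell (i - 1, 0)) None w -> mark_ev U D (cell (i + 1, 0)) None w ->
  exists x : R, i%:~R * a <= x < i%:~R * a + a /\
    (tau (v, dv) (x < 0)%R <= `|x|%:E)%E.
Proof.
move=> reg evo hi [n _ [[/in_cell[xn yn] nuniq] Dn]] em ep.
rewrite mul0r add0r in yn.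
have hfar : (1 <= i%:~R :> R) || (i%:~R <= -2 :> R).
  by move: hi; rewrite -(ler_int R) -[X in _ || X](ler_int R).
have xfar : a <= `|along n w|.
  rewrite ler_normr; case/orP: hfar => ?; apply/orP; [left|right]; nra.
exists (along n w); split => //.
have Sn : S w (U n w, D n w) by left; exists n.
apply: (stopped_by_block (regular_generic reg) evo (a := a)) => //=.
- by right.
- move=> k [[m _ <-]|->] /= kd; last first.
    by move=> _; rewrite /rel_trans subrr ltxx.
  rewrite -/(along m w) -/(along n w) -/(trans m w) => xmn /andP[ym0 yma].
  have {}ym0 := ltW ym0.
  have row j : cell (j, 0) (U m w) <-> j%:~R * a <= along m w < j%:~R * a + a.
    rewrite in_cell mul0r add0r ym0 yma; split; first by case.
    by move=> ?.
  move: xmn; rewrite ltr_norml => /andP[x1 x2]; move: xn => /andP[xn1 xn2].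
  have [lo|lo] := ltP (along m w) (i%:~R * a).
    apply: (em m); apply/row; rewrite rmorphB/=; apply/andP; split; lra.
  have [up|up] := ltP (along m w) (i%:~R * a + a).
    have mn : m = n by apply: nuniq; apply/row; rewrite lo.
    by move: kd Dn; rewrite mn /= => -> /eqP; case: dv.
  apply: (ep m); apply/row; rewrite rmorphD/=; apply/andP; split; lra.
Qed.

(** One triple on each side of [v], so that a single block stops both rays. *)
Definition block (k : nat) : seq (int * int) :=
  [seq (i, 0) | i <- [:: 3 * k%:Z; 3 * k%:Z + 1; 3 * k%:Z + 2;
                         - 3 * k%:Z - 1; - 3 * k%:Z - 2; - 3 * k%:Z - 3]].

(** The middle cells [3k + 1] and [- 3k - 2] are both congruent to 1 modulo 3, so one marking serves
    all blocks. *)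
Definition block_mark (c : int * int) : option bool :=
  if (c.1 %% 3)%Z == 1 then Some (~~ dv) else None.

Lemma block_stops w tau k s : regular U v w -> gilbert_evolution (S w) tau ->
  (\bigcap_(c in [set` block k]) mark_ev U D (cell c) (block_mark c)) w ->
  (tau (v, dv) s <= (3 * k.+1%:R * a)%:E)%E.
Proof.
move=> reg evo blk.
have mark i o : (i, 0) \in block k -> block_mark (i, 0) = o ->
    mark_ev U D (cell (i, 0)) o w by move=> ib <-; exact: blk.
have ka : 0 <= k%:R * a by rewrite mulr_ge0// ltW.
case: s.
  have [|||| x [/andP[x1 x2] ]] := @gap_blocks w tau (- 3 * k%:Z - 2) reg evo.
  - by apply/orP; right; lia.
  - by apply: mark; [rewrite !inE eqxx ?orbT|rewrite /block_mark/= ifT//; lia].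
  - have -> : - 3 * k%:Z - 2 - 1 = - 3 * k%:Z - 3 by lia.
    by apply: mark; [rewrite !inE eqxx ?orbT|rewrite /block_mark/= ifF//; lia].
  - have -> : - 3 * k%:Z - 2 + 1 = - 3 * k%:Z - 1 by lia.
    by apply: mark; [rewrite !inE eqxx ?orbT|rewrite /block_mark/= ifF//; lia].
  have kE : (- 3 * k%:Z - 2)%:~R = - (3 * k%:R) - 2 :> R.
    by rewrite rmorphB rmorphM rmorphN/= mulNr.
  rewrite kE in x1 x2.
  have x0 : x < 0 by nra.
  rewrite x0 ltr0_norm// => /le_trans; apply.
  by rewrite lee_fin -natr1; nra.
have [|||| x [/andP[x1 x2] ]] := @gap_blocks w tau (3 * k%:Z + 1) reg evo.
- by apply/orP; left; lia.
- by apply: mark; [rewrite !inE eqxx ?orbT|rewrite /block_mark/= ifT//; lia].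
- have -> : 3 * k%:Z + 1 - 1 = 3 * k%:Z by lia.
  by apply: mark; [rewrite !inE eqxx ?orbT|rewrite /block_mark/= ifF//; lia].
- have -> : 3 * k%:Z + 1 + 1 = 3 * k%:Z + 2 by lia.
  by apply: mark; [rewrite !inE eqxx ?orbT|rewrite /block_mark/= ifF//; lia].
have kE : (3 * k%:Z + 1)%:~R = 3 * k%:R + 1 :> R by rewrite rmorphD rmorphM.
rewrite kE in x1 x2.
have x0 : 0 <= x by nra.
rewrite ltNge x0 /= ger0_norm// => /le_trans; apply.
by rewrite lee_fin -natr1; nra.
Qed.

Definition shield_cells (N : nat) : seq (int * int) :=
  [seq (i%:Z, j) | i <- iota 0 N, j <- [:: -2; -1; 0; 1]].

Definition shield_mark (c : int * int) : option bool :=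
  if (c.2 == 0) || (c.2 == -1) then Some dv else None.

Lemma shields_protect w tau N : regular U v w -> gilbert_evolution (S w) tau ->
  (\bigcap_(c in [set` shield_cells N]) mark_ev U D (cell c) (shield_mark c)) w ->
  ((N%:R * a)%:E <= tau (v, dv) false)%E.
Proof.
move=> reg evo sh.
have mark (i : nat) j o : (i < N)%N -> j \in [:: -2; -1; 0; 1] ->
    shield_mark (i%:Z, j) = o -> mark_ev U D (cell (i%:Z, j)) o w.
  move=> iN jr <-; apply: sh; apply/allpairsP; exists (i, j); split => //.
  by rewrite mem_iota.
have Sg : S w (v, dv) by right.
have colE (i : nat) (x : R) : i%:R * a <= x < i.+1%:R * a <->
    i%:Z%:~R * a <= x < i%:Z%:~R * a + a.
  by rewrite -natr1 mulrDl mul1r.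
apply: (sheltered (regular_generic reg) evo (a := a)) => //=.
- move=> i iN; split.
    have [n _ [[/in_cell[xn yn] _] /= Dn]] := mark i 0 (Some dv) iN isT erefl.
    exists (U n w, D n w); split => //=.
    - by left; exists n.
    - exact/colE.
    (* The closed edge of row [0] is the line of [v]; regularity makes the height strictly
       positive. *)
    - rewrite mul0r add0r in yn; case/andP: yn => yn0 ->; rewrite andbT lt_neqAle yn0.
      rewrite andbT eq_sym subr_eq0; apply/eqP.
      by case: reg => _ _ + _; apply.
  have [n _ [[/in_cell[xn yn] _] /= Dn]] := mark i (-1) (Some dv) iN isT erefl.
  exists (U n w, D n w); split => //=.
  - by left; exists n.
  - exact/colE.
  - by move: yn; rewrite rmorphN/= mulN1r addNr.
- move=> i k iN [[m _ <-]|->] /= kd; last by case: dv kd.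
  rewrite -/(along m w) -/(trans m w) => /colE xm /andP[ym1 ym2].
  have row j : j%:~R * a <= trans m w < j%:~R * a + a -> cell (i%:Z, j) (U m w).
    by move=> ym; apply/in_cell.
  (* An inner cell contains only its shield, which is parallel to [v]. *)
  have full j : shield_mark (i%:Z, j) = Some dv -> j \in [:: -2; -1; 0; 1] ->
      cell (i%:Z, j) (U m w) -> False.
    move=> jm jr cm; have [n _ [[_ nuniq] /= Dn]] := mark i j _ iN jr jm.
    by move: kd; rewrite (nuniq m cm) Dn; case: dv.
  have [y1|y1] := ltP (trans m w) (- a).
    have em := mark i (-2) None iN isT erefl.
    apply: (em m); apply: row; rewrite rmorphN/=; apply/andP; split; lra.
  have [y2|y2] := ltP (trans m w) 0.
    by apply: (full (-1)) => //; apply: row; rewrite rmorphN/=; apply/andP; split; lra.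
  have [y3|y3] := ltP (trans m w) a.
    by apply: (full 0) => //; apply: row; rewrite /=; apply/andP; split; lra.
  have em := mark i 1 None iN isT erefl.
  apply: (em m); apply: row; rewrite /=; apply/andP; split; lra.
Qed.

Lemma shields_prob N :
  P (\bigcap_(c in [set` shield_cells N]) mark_ev U D (cell c) (shield_mark c)) =
  ((q ^+ 4 / 4) ^+ N)%:E.
Proof.
rewrite cells_prob; last first.
  by apply: allpairs_uniq; rewrite ?iota_uniq// => -[i j] [i' j'] _ _ /= [-> ->].
congr _%:E; rewrite /shield_cells big_allpairs_dep.
under eq_bigr => i _.
  rewrite !big_cons big_nil /shield_mark /=.
  over.
rewrite big_const_seq count_predT size_iota iter_mulr_1; congr (_ ^+ _).
by field.
Qed.

(** Six cells, two of them with a prescribed direction, give [q ^+ 6 / 4] for the presence of one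
    block. *)
Lemma blocks_absent_prob N :
  P (\bigcap_(k in `I_N)
       ~` (\bigcap_(c in [set` block k]) mark_ev U D (cell c) (block_mark c))) =
  ((1 - q ^+ 6 / 4) ^+ N)%:E.
Proof.
have := @blocks_prob _ _ _ P _ (fun c => mark_ev U D (cell c) (block_mark c))
  (weight \o block_mark) block (q ^+ 6 / 4) _ _ _ _ _ N [::].
rewrite set_nil bigcap_set0 setIT big_nil mulr1 => -> //.
- by move=> c; exact: measurable_cell_mark.
- exact: cells_prob.
- move=> k; rewrite map_inj_uniq; last by move=> ? ? [].
  by rewrite /= !inE; lia.
- move=> k k' c /mapP[i ik ->] /mapP[j jk [ij]]; subst j.
  by move: ik jk; rewrite !inE; lia.
- move=> k; rewrite !big_cons big_nil /block_mark /=.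
  have -> : (3 * k%:Z %% 3)%Z = 0 by lia.
  have -> : ((3 * k%:Z + 1) %% 3)%Z = 1 by lia.
  have -> : ((3 * k%:Z + 2) %% 3)%Z = 2 by lia.
  have -> : ((- 3 * k%:Z - 1) %% 3)%Z = 2 by lia.
  have -> : ((- 3 * k%:Z - 2) %% 3)%Z = 1 by lia.
  have -> : ((- 3 * k%:Z - 3) %% 3)%Z = 0 by lia.
  by rewrite /=; field.
Qed.

Lemma length_lower_bound t T : 0 < t -> t < T ->
  exists E, [/\ measurable E,
    E `<=` [set w | (t%:E < gilbert_length (S w) (v, dv) T)%E] &
    ((expR (-6) * expR (- 6 * Num.sqrt lambda * t))%:E <= P E)%E].
Proof.
move=> t0 tT; have [Uinj Upois _ _] := UD.
have [N0 [mN0 PN0 sN0]] := regular_ae lambda0 Uinj Upois v.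
(* The successor makes [N * a] exceed [t] strictly. *)
pose N := (Num.truncn (t / a)).+1.
set C := \bigcap_(c in [set` shield_cells N]) mark_ev U D (cell c) (shield_mark c).
have mC : measurable C.
  by apply: fin_bigcap_measurable => // c _; exact: measurable_cell_mark.
exists (C `\` N0); split; first exact: measurableD.
  move=> w [Cw nN0]; have reg : regular U v w.
    by apply: contrapT => nreg; apply: nN0; exact: sN0.
  have evo := gilbertP (regular_generic reg) (regular_locally_finite reg).
  apply: (gilbert_length_gt t0 tT _ (shields_protect reg evo Cw)).
  by rewrite -ltr_pdivrMr// truncnS_gt.
rewrite (@measure_eq_off_negligible _ _ _ P _ C N0) ?shields_prob//; last 3 first.
- exact: measurableD.
- by exists N0; split.
- by move=> w nN0; split=> [[]|].
have q0 : 0 <= q by exact: expR_ge0.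
(* This amounts to [expR (-2) <= 1 / 4], which follows from [expR 1 >= 2]. *)
have e6 : expR (-6) <= q ^+ 4 / 4.
  have -> : expR (-6) = q ^+ 4 * expR (-1) ^+ 2.
    by rewrite -exprD /q -expRM_natl; congr expR; lra.
  rewrite ler_wpM2l ?exprn_ge0// expRN exprVn lef_pV2 ?posrE ?exprn_gt0 ?expR_gt0//.
  have := expR_ge1Dx (1 : R); nra.
rewrite lee_fin -expRD; apply: (@le_trans _ _ (expR (-6) ^+ N)); last first.
  by rewrite lerXn2r ?nnegrE ?expR_ge0// divr_ge0 ?exprn_ge0.
rewrite -expRM_natl ler_expR.
have ta : Num.sqrt lambda * t = t / a by rewrite /a invrK mulrC.
have := truncn_itv (divr_ge0 (ltW t0) (ltW a0)); rewrite -mulrA ta.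
move=> /andP[le _]; rewrite /N -natr1; lra.
Qed.

Lemma length_upper_bound t T : 0 < t -> t < T ->
  exists E, [/\ measurable E,
    [set w | (t%:E < gilbert_length (S w) (v, dv) T)%E] `<=` E &
    (P E <= (expR (q ^+ 6 / 4) *
             expR (- (q ^+ 6 / 24) * Num.sqrt lambda * t))%:E)%E].
Proof.
move=> t0 tT; have [Uinj Upois _ _] := UD.
have [N0 [mN0 PN0 sN0]] := regular_ae lambda0 Uinj Upois v.
(* Block [k] bounds each ray by [3 (k + 1) a], hence both together by [6 N a <= t] when [k < N]: a
   length above [t] forces all [N] blocks to be absent. *)
pose N := Num.truncn (t / (6 * a)).
have a60 : 0 < 6 * a by rewrite mulr_gt0.
have /andP[Nt tN] := truncn_itv (divr_ge0 (ltW t0) (ltW a60)); rewrite -/N in Nt tN.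
set X := \bigcap_(k in `I_N) ~` (\bigcap_(c in [set` block k])
  mark_ev U D (cell c) (block_mark c)).
have mX : measurable X.
  apply: fin_bigcap_measurable => // k _; apply: measurableC.
  by apply: fin_bigcap_measurable => // c _; exact: measurable_cell_mark.
exists (X `|` N0); split; first exact: measurableU.
  move=> w /= tw; have [N0w|nN0] := pselect (N0 w); [by right|left].
  have reg : regular U v w.
    by apply: contrapT => nreg; apply: nN0; exact: sN0.
  move=> k /= kN blk; move: tw; rewrite ltNge => /negP; apply.
  have M0 : 0 <= 3 * k.+1%:R * a by rewrite !mulr_ge0// ltW.
  apply: (le_trans (gilbert_length_le T M0 _)).
    by move=> tau s evo; exact: (block_stops s reg evo blk).
  rewrite lee_fin; rewrite ler_pdivlMr// in Nt; apply: le_trans Nt.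
  have : 0 <= a * (N%:R - k.+1%:R) by rewrite mulr_ge0 ?(ltW a0)// subr_ge0 ler_nat.
  by lra.
rewrite (@measure_eq_off_negligible _ _ _ P _ X N0) ?blocks_absent_prob//; last 3 first.
- exact: measurableU.
- by exists N0; split.
- by move=> w nN0; split=> [[]//|]; left.
set p := q ^+ 6 / 4.
have p0 : 0 <= p by rewrite divr_ge0// exprn_ge0// expR_ge0.
have p1 : p <= 1.
  have q1 : q <= 1 by rewrite -[leRHS]expR0 ler_expR; lra.
  have : q ^+ 6 <= 1 by rewrite exprn_ile1// expR_ge0.
  by rewrite /p; lra.
rewrite lee_fin -expRD; apply: (@le_trans _ _ (expR (- p) ^+ N)).
  rewrite lerXn2r ?nnegrE ?expR_ge0 ?subr_ge0//.
  exact: expR_ge1Dx.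
rewrite -expRM_natl ler_expR.
have ta : Num.sqrt lambda * t = 6 * (t / (6 * a)).
  have s0 : Num.sqrt lambda != 0 by rewrite gt_eqF// sqrtr_gt0.
  by rewrite /a; field.
(* As [N] exceeds [t / (6 a) - 1], the exponent [- p N] is at most [p] minus [p / 6] times
   [t / a]. *)
have -> : q ^+ 6 / 24 = p / 6 by rewrite /p; field.
rewrite -mulrA ta; move: tN; set y := t / _; rewrite -[N.+1%:R]natr1 => yN.
have : 0 <= p * (N%:R + 1 - y) by rewrite mulr_ge0// subr_ge0 ltW.
by lra.
Qed.

End grid.

Theorem theorem2p1 (R : realType) :
  exists c1 c2 alpha1 alpha2 : R,
    [/\ 0 < c1, 0 < c2, alpha1 >= alpha2, alpha2 > 0 &
      forall (disp : measure_display) (Omega : measurableType disp)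
        (P : probability Omega R) (lambda : R)
        (U : nat -> {RV P >-> (R * R)%type}) (D : nat -> {RV P >-> bool}),
      0 < lambda -> poisson_germs lambda U D ->
      forall (v : R * R) (dv : bool) (t T : R), 0 < t -> t < T ->
      prob_between P
        [set w | (t%:E < gilbert_length
                           (germ_set U D w `|` [set (v, dv)]) (v, dv) T)%E]
        (c1 * expR (- alpha1 * Num.sqrt lambda * t))%:E
        (c2 * expR (- alpha2 * Num.sqrt lambda * t))%:E].
Proof.
pose q : R := expR (-1).
have q0 : 0 < q by exact: expR_gt0.
(* Both prefactors account for rounding [t] to a whole number of columns or blocks. *)
exists (expR (-6)), (expR (q ^+ 6 / 4)), 6, (q ^+ 6 / 24); split.
- exact: expR_gt0.
- exact: expR_gt0.
- have q1 : q <= 1 by rewrite -[leRHS]expR0 ler_expR; lra.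
  have : q ^+ 6 <= 1 by rewrite exprn_ile1// ltW.
  by lra.
- by rewrite divr_gt0// exprn_gt0.
move=> disp Omega P lambda U D lambda0 UD v dv t T t0 tT; split.
  exact: (length_lower_bound v dv lambda0 UD t0 tT).
exact: (length_upper_bound v dv lambda0 UD t0 tT).
Qed.
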